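(* Let $Y=(Y^1,\ldots,Y^d)$ be the multivariate fractional Ornstein--Uhlenbeck process with parameters $\alpha_i,\nu_i>0$, $H_i\in(0,1)\setminus\{1/2\}$ ($i=1,\dots,d$), $\rho_{ij},\eta_{ij}$ ($i,j=1,\dots,d$). Then $Y$ is strongly (strictly) stationary with $\mathbb{E}[Y_t]=(0,\ldots,0)$ for all $t\in\mathbb{R}$. Moreover, for $i,j\in\{1,\ldots,d\}$ and $t>s$, put $$I_{ij}(t-s)=\int_0^{t-s} e^{\alpha_i u}\Big(\int_{-\infty}^0 e^{\alpha_j v}(u-v)^{H_{ij}-2}\,dv\Big)du .$$ The covariance function $r_{ij}(t-s)=\mathrm{Cov}(Y^i_t,Y^j_s)$ is given as follows. (a) If $H_{ij}=H_i+H_j\neq 1$, $$r_{ij}(t-s)=e^{-\alpha_i(t-s)}\mathrm{Cov}(Y^i_0,Y^j_0)+\nu_i\nu_j e^{-\alpha_i(t-s)}H_{ij}(H_{ij}-1)\frac{\rho_{ij}+\eta_{ij}}{2}I_{ij}(t-s),$$ where $$\mathrm{Cov}(Y^i_0,Y^j_0)=\frac{\Gamma(H_{ij}+1)\nu_i\nu_j}{2(\alpha_i+\alpha_j)}\Big((\alpha_i^{1-H_{ij}}+\alpha_j^{1-H_{ij}})\rho_{ij}+(\alpha_j^{1-H_{ij}}-\alpha_i^{1-H_{ij}})\eta_{ij}\Big).$$ (b) If $H_{ij}=1$, $$r_{ij}(t-s)=e^{-\alpha_i(t-s)}\mathrm{Cov}(Y^i_0,Y^j_0)-\nu_i\nu_j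 e^{-\alpha_i(t-s)}\frac{\eta_{ij}}{2}I_{ij}(t-s),$$ where $$\mathrm{Cov}(Y^i_0,Y^j_0)=\frac{\nu_i\nu_j}{\alpha_i+\alpha_j}\Big(\rho_{ij}+\frac{\eta_{ij}}{2}(\log\alpha_j-\log\alpha_i)\Big).$$ The correlation $\mathrm{Corr}(Y^i_t,Y^j_t)$ is given, for $H_{ij}\neq1$, by $$\frac{\Gamma(H_{ij}+1)}{\sqrt{\Gamma(2H_i+1)\Gamma(2H_j+1)}}\Big(\frac{\alpha_i^{H_i}\alpha_j^{H_j}}{\alpha_i+\alpha_j}\Big)\Big((\alpha_i^{1-H_{ij}}+\alpha_j^{1-H_{ij}})\rho_{ij}+(\alpha_j^{1-H_{ij}}-\alpha_i^{1-H_{ij}})\eta_{ij}\Big),$$ and, for $H_{ij}=1$, by $$\frac{1}{\sqrt{\Gamma(2H_i+1)\Gamma(2H_j+1)}}\Big(\frac{2\alpha_i^{H_i}\alpha_j^{H_j}}{\alpha_i+\alpha_j}\Big)\Big(\rho_{ij}+\frac{\eta_{ij}}{2}(\log\alpha_j-\log\alpha_i)\Big).$$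
   Context: Let $d\in\mathbb{N}$, $H_1,\dots,H_d\in(0,1)\setminus\{1/2\}$, $H_{ij}=H_i+H_j$. A $d$-variate fractional Brownian motion is a centered Gaussian process $(B^{H_1}_t,\dots,B^{H_d}_t)_{t\in\mathbb{R}}$ in $\mathbb{R}^d$ (taken with continuous paths) such that each $B^{H_i}$ is a fractional Brownian motion with Hurst index $H_i$; for every $\lambda>0$, $(B^{H_1}_{\lambda t},\dots,B^{H_d}_{\lambda t})_{t}$ and $(\lambda^{H_1}B^{H_1}_t,\dots,\lambda^{H_d}B^{H_d}_t)_{t}$ have the same finite-dimensional distributions; and it has stationary increments. We normalize $\mathrm{Var}(B^{H_i}_1)=1$. For $i\ne j$ there are then (known fact) $\rho_{ij}=\rho_{ji}\in[-1,1]$, $\eta_{ij}=-\eta_{ji}\in\mathbb{R}$ with $\rho_{ij}=\mathrm{Corr}(B_1^{H_i},B_1^{H_j})$ and, for $t,s\in\mathbb{R}$: if $H_{ij}\ne1$, $$\mathrm{Cov}(B^{H_i}_t,B^{H_j}_s)=\tfrac12\big((\rho_{ij}+\mathrm{sign}(t)\eta_{ij})|t|^{H_{ij}}+(\rho_{ij}-\mathrm{sign}(s)\eta_{ij})|s|^{H_{ij}}-(\rho_{ij}-\mathrm{sign}(s-t)\eta_{ij})|s-t|^{H_{ij}}\big);$$ if $H_{ij}=1$, $$\mathrm{Cov}(B^{H_i}_t,B^{H_j}_s)=\tfrac12\big(\rho_{ij}(|s|+|t|-|s-t|)+\eta_{ij}(s\log|s|-t\log|t|-(s-t)\log|s-t|)\big),$$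 where $\mathrm{sign}(x)=1$ for $x\ge0$, $-1$ for $x<0$, and $0\log0=0$. For $i=j$ we set $\rho_{ii}=1$, $\eta_{ii}=0$. For $\alpha_i,\nu_i>0$, the multivariate fractional Ornstein--Uhlenbeck process $Y=(Y^1_t,\dots,Y^d_t)_{t\in\mathbb{R}}$ is $$Y^i_t=\nu_i\int_{-\infty}^te^{-\alpha_i(t-u)}dB^{H_i}_u,\quad i=1,\dots,d,$$ with pathwise Riemann--Stieltjes integrals, i.e. $Y^i_t=\nu_i\big(B^{H_i}_t-\alpha_i\int_{-\infty}^tB^{H_i}_ue^{-\alpha_i(t-u)}du\big)$ almost surely. *)

(* Defs.v *)
From HB Require Import structures.
From mathcomp Require Import all_boot all_order all_algebra.
From mathcomp Require Import all_classical all_reals all_analysis.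

Set Implicit Arguments.
Unset Strict Implicit.
Unset Printing Implicit Defensive.

Import Order.TTheory GRing.Theory Num.Theory.
Import numFieldNormedType.Exports.

Local Open Scope classical_set_scope.
Local Open Scope ring_scope.

Section real_functions.
Context {R : realType}.
Implicit Types (a b t l : R) (f g : R -> R).

Definition Gamma (a : R) : R :=
  \int[lebesgue_measure]_(x in `]0, +oo[) (x `^ (a - 1) * expR (- x)).

(* Unlike Num.sg, this sign takes the value 1 at 0. *)
Definition sign (x : R) : R := if 0 <= x then 1 else -1.

(* Riemann-Stieltjes integral of f against g over [a, b], as the limit of
   tagged sums when the mesh tends to 0.  A partition is given by a and the
   strictly increasing list s of its remaining points, of which b is the last;
   the k-th cell is [nth b (a :: s) k, nth b s k], with tag xi k. *)
Definition tagged_partition (a b : R) (s : seq R) (xi : nat -> R) (delta : R) :=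
  itv_partition a b s /\
  forall k, (k < size s)%N ->
    [/\ nth b (a :: s) k <= xi k, xi k <= nth b s k &
        nth b s k - nth b (a :: s) k < delta].

Definition RS_sum f g (a b : R) (s : seq R) (xi : nat -> R) : R :=
  \sum_(k < size s) f (xi k) * (g (nth b s k) - g (nth b (a :: s) k)).

Definition is_RS_integral f g (a b l : R) :=
  forall eps : R, 0 < eps -> exists2 delta : R, 0 < delta &
    forall s xi, tagged_partition a b s xi delta ->
      `|RS_sum f g a b s xi - l| < eps.

(* l is the improper integral of f against g over ]-oo, t]. *)
Definition is_improper_RS_integral f g (t l : R) :=
  exists2 J : R -> R,
    (forall a, a <= t -> is_RS_integral f g a t (J a)) &
    J a @[a --> -oo] --> l.

End real_functions.

Section processes.
Context (dT : measure_display) (T : measurableType dT) (R : realType).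
Variable P : probability T R.

Definition correlation (X Y : T -> R) : R :=
  fine (covariance P X Y) /
  (Num.sqrt (fine 'V_P[X]) * Num.sqrt (fine 'V_P[Y])).

(* The Dirac mass is a separate case because normal_prob m 0 is not the
   degenerate normal law. *)
Definition centered_gaussian (Z : T -> R) :=
  (forall A : set R, measurable A -> P (Z @^-1` A) = \d_(0 : R) A) \/
  (exists2 sigma : R, 0 < sigma &
    forall A : set R, measurable A -> P (Z @^-1` A) = normal_prob 0 sigma A).

Definition centered_gaussian_process (I : Type) (X : I -> T -> R) :=
  forall n (idx : 'I_n -> I) (c : 'I_n -> R),
    centered_gaussian (fun w => \sum_(k < n) c k * X (idx k) w).

(* Equality of the finite-dimensional distributions, as laws on R^n with its
   product sigma-algebra. *)
Definition same_fdd (I : Type) (X Y : I -> T -> R) :=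
  forall n (idx : 'I_n -> I) (A : set (n.-tuple R)), measurable A ->
    P ((fun w => [tuple X (idx k) w | k < n]) @^-1` A) =
    P ((fun w => [tuple Y (idx k) w | k < n]) @^-1` A).

(* Scalar fractional Brownian motion, up to a multiplicative constant. *)
Definition is_fBm (h : R) (X : R -> T -> R) :=
  centered_gaussian_process X /\
  forall t s : R, covariance P (X t) (X s) =
    ('V_P[X 1%R] *
      ((`|t| `^ (2 * h) + `|s| `^ (2 * h) - `|t - s| `^ (2 * h)) / 2)%R%:E)%E.

(* For vector-valued processes the finite-dimensional distributions range over
   pairs (component, time). *)
Record is_mfBm (d : nat) (H : 'I_d -> R) (B : 'I_d -> R -> {RV P >-> R}) :
    Prop := IsMfBm {
  mfBm_gaussian :
    centered_gaussian_process (fun (p : 'I_d * R) w => B p.1 p.2 w) ;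
  mfBm_continuous : forall i w, continuous (fun t : R => B i t w) ;
  mfBm_marginal : forall i, is_fBm (H i) (fun t => B i t) ;
  mfBm_selfsimilar : forall lambda : R, 0 < lambda ->
    same_fdd (fun (p : 'I_d * R) w => B p.1 (lambda * p.2) w)
             (fun (p : 'I_d * R) w => lambda `^ H p.1 * B p.1 p.2 w) ;
  mfBm_stationary_increments : forall h : R,
    same_fdd (fun (p : 'I_d * R) w => B p.1 (p.2 + h) w - B p.1 h w)
             (fun (p : 'I_d * R) w => B p.1 p.2 w - B p.1 0 w) ;
  mfBm_normalized : forall i, 'V_P[B i 1%R] = 1%E }.

(* Since ln 0 = 0, x * ln `|x| vanishes at 0. *)
Definition mfBm_cov (Hij rho eta t s : R) : R :=
  if Hij == 1 then
    (rho * (`|s| + `|t| - `|s - t|) +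
     eta * (s * ln `|s| - t * ln `|t| - (s - t) * ln `|s - t|)) / 2
  else
    ((rho + sign t * eta) * `|t| `^ Hij +
     (rho - sign s * eta) * `|s| `^ Hij -
     (rho - sign (s - t) * eta) * `|s - t| `^ Hij) / 2.

(* rho and eta are the correlation and asymmetry parameters of the
   multivariate fractional Brownian motion B. *)
Record mfBm_parameters (d : nat) (H : 'I_d -> R)
    (B : 'I_d -> R -> {RV P >-> R}) (rho eta : 'I_d -> 'I_d -> R) : Prop :=
    MfBmParameters {
  rho_diag : forall i, rho i i = 1 ;
  eta_diag : forall i, eta i i = 0 ;
  rho_sym : forall i j, i != j -> rho i j = rho j i ;
  eta_antisym : forall i j, i != j -> eta i j = - eta j i ;
  rho_bound : forall i j, i != j -> -1 <= rho i j <= 1 ;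
  rho_correlation : forall i j, i != j ->
    rho i j = correlation (B i 1) (B j 1) ;
  mfBm_covariance : forall i j, i != j -> forall t s : R,
    covariance P (B i t) (B j s) =
    (mfBm_cov (H i + H j) (rho i j) (eta i j) t s)%:E }.

(* Y^i_t = nu_i \int_{-oo}^t e^{-alpha_i (t - u)} dB^i_u as a pathwise
   Riemann-Stieltjes integral, almost surely for each i and t. *)
Definition is_mfOU (d : nat) (B : 'I_d -> R -> {RV P >-> R})
    (alpha nu : 'I_d -> R) (Y : 'I_d -> R -> {RV P >-> R}) :=
  forall i t, {ae P, forall w, exists2 l : R,
    is_improper_RS_integral (fun u => expR (- alpha i * (t - u)))
                            (fun u => B i u w) t l &
    Y i t w = nu i * l}.

Definition strictly_stationary (d : nat) (Y : 'I_d -> R -> {RV P >-> R}) :=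
  forall h : R,
    same_fdd (fun (p : 'I_d * R) w => Y p.1 (p.2 + h) w)
             (fun (p : 'I_d * R) w => Y p.1 p.2 w).

End processes.

(* The integral I_{ij}(x), with ai = alpha_i and aj = alpha_j. *)
Definition mfOU_I (R : realType) (Hij ai aj x : R) : R :=
  \int[lebesgue_measure]_(u in `[0, x])
    (expR (ai * u) *
     \int[lebesgue_measure]_(v in `]-oo, 0])
        (expR (aj * v) * (u - v) `^ (Hij - 2))).

(* Main.v *)
Require Import Defs.
From HB Require Import structures.
From mathcomp Require Import all_boot all_order all_algebra.
From mathcomp Require Import all_classical all_reals all_analysis.
From mathcomp Require Import measurable_realfun.
From mathcomp Require Import ring lra.

Set Implicit Arguments.
Unset Strict Implicit.
Unset Printing Implicit Defensive.

Import Order.TTheory GRing.Theory Num.Theory.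
Import numFieldNormedType.Exports.

Local Open Scope classical_set_scope.
Local Open Scope ring_scope.

(** Write e_a for the density of the exponential law of rate a, and B, Y for
    the driving and the filtered process.  The whole proof rests on the
    representation, almost surely,

      Y^i_t = nu_i \int e_{alpha_i}(x) (B^i_t - B^i_{t-x}) dx,

    that is, Y^i_t is an exponential average of past increments of B.  It is
    obtained path by path: summation by parts turns the Riemann-Stieltjes
    integral over [t - N, t] into

      e^{-alpha N} (B_t - B_{t-N}) + \int_0^N e_alpha(x) (B_t - B_{t-x}) dx

    ([grid_sum_exp]).  Since E(B_t - B_{t-x})^2 = |x|^{2H}, Fubini makes the
    integrand absolutely integrable on (0, oo) for almost every path; as the
    left-hand side converges, so does the boundary term, which is the integrand
    at N up to the factor alpha, and an integrable function can only converge
    to 0 ([improper_RS_value]).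

    Means and covariances.  Fubini then gives E Y = 0 and
      Cov(Y^i_t, Y^j_s) = nu_i nu_j \int e_a(x) \int e_b(y) G(x, y) dy dx,
    where G(x, y) is the covariance of the two increments.  The parts of the
    covariance of B which depend on one time only cancel in G, which becomes
      k(tau) - k(tau - x) - k(tau + y) + k(tau - x + y),  tau = t - s,
    for a kernel k of the lag alone ([mfBm_cov_increments]).  What remains is
    calculus in one variable on [stat_cov], the double exponential mean of the
    above:
    - at lag 0, memorylessness of the exponential law collapses the double mean
      to one-dimensional exponential means of k ([stat_cov0]), which are values
      of Gamma, or for H_i + H_j = 1 a logarithm;
    - at lag tau > 0, e^{a tau} stat_cov(tau) - stat_cov(0) is a primitive: its
      derivative is e^{a tau} times \int_0^oo e^{-b y} (-k'')(tau + y) dy, and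
      k'' is a multiple of a power, so one recovers the integral I_ij
      ([stat_cov_integral]).  The singularity of k'' at 0 is integrable, and is
      dealt with by monotone convergence ([ge0_FTC2_open0]).

    Stationarity.  The sums which approximate Y_{t+h} are fixed linear
    combinations of increments of B shifted by h; their finite-dimensional laws
    do not depend on h because B has stationary increments, and equality of
    finite-dimensional laws survives linear combinations ([same_fdd_linear])
    and almost sure limits ([same_fdd_lim]).  Two limits are taken: first the
    mesh, then the truncation N. *)

(** * Affine changes of variables for Lebesgue measure *)

Section affine.
Context {R : realType}.
Notation mu := (@lebesgue_measure R).
Implicit Types (a b : R).

Lemma measurable_affine a b :
  measurable_fun setT (fun x : R => a * x + b : measurableTypeR R).
Proof. by apply: measurable_funD => //; apply: measurable_funM. Qed.

Definition affine_image a b (a0 : 0 < a) :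
    {measure set (measurableTypeR R) -> \bar R} :=
  mscale (NngNum (ltW a0))
    (measure_function_pushforward__canonical__measure_function_Measure
       mu (measurable_affine a b)).

(** Both sides are measures agreeing on the intervals ]c, d], which determine
    Lebesgue measure. *)
Lemma lebesgue_measure_affine a b (A : set R) (a0 : 0 < a) : measurable A ->
  mu A = affine_image b a0 A.
Proof.
move=> mA; apply: lebesgue_measure_unique => //= _ [[c d] _ <-]/=.
rewrite /affine_image /mscale/= /pushforward.
rewrite (_ : _ @^-1` _ = `](c - b) / a, (d - b) / a]%classic).
  rewrite !lebesgue_measure_itv/= !lte_fin ltr_pM2r ?invr_gt0// ltrD2r.
  case: ifPn => _; last by rewrite mule0.
  by rewrite -!EFinB -EFinM; congr (_%:E); field; rewrite gt_eqF.
apply/seteqP; split => x /=; rewrite !in_itv/= => /andP[h1 h2]; apply/andP.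
  by rewrite ltr_pdivrMr// ler_pdivlMr// mulrC ltrBlDr lerBrDr.
by move: h1 h2; rewrite ltr_pdivrMr// ler_pdivlMr// mulrC ltrBlDr lerBrDr.
Qed.

Lemma ge0_integral_affine (f : R -> \bar R) a b : 0 < a ->
  measurable_fun setT f -> (forall x, 0 <= f x)%E ->
  (\int[mu]_x f x = a%:E * \int[mu]_x f (a * x + b)%R)%E.
Proof.
move=> a0 mf f0.
rewrite (eq_measure_integral (affine_image b a0)).
  rewrite /affine_image ge0_integral_mscale//= ge0_integral_pushforward//.
  exact: measurable_affine.
by move=> A mA _; exact: lebesgue_measure_affine.
Qed.

Lemma integrable_affine (f : R -> \bar R) a b : 0 < a ->
  mu.-integrable setT f -> mu.-integrable setT (fun x => f (a * x + b)).
Proof.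
move=> a0 /integrableP[mf fi]; apply/integrableP; split.
  exact: (measurableT_comp mf (measurable_affine a b)).
move: fi; rewrite (ge0_integral_affine b a0)//=; last exact: measurableT_comp.
move=> h; apply/negP => /negP; rewrite -leNgt leye_eq => /eqP E.
by move: h; rewrite E gt0_muley// lte_fin.
Qed.

Lemma integral_affine (f : R -> \bar R) a b : 0 < a ->
  mu.-integrable setT f ->
  (\int[mu]_x f x = a%:E * \int[mu]_x f (a * x + b)%R)%E.
Proof.
move=> a0 fi; have mf := measurable_int _ fi.
rewrite integralE [in RHS]integralE.
have fia := integrable_affine b a0 fi.
have e1 := integrable_fin_num measurableT (integrable_funepos measurableT fia).
have e2 := integrable_fin_num measurableT (integrable_funeneg measurableT fia).
rewrite muleBr ?e1// ?fin_num_adde_defr//.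
rewrite (ge0_integral_affine b a0 (measurable_funepos mf))//.
rewrite (ge0_integral_affine b a0 (measurable_funeneg mf))//.
by congr (_ * _ - _ * _)%E; apply: eq_integral => x _;
  rewrite ?funeposE ?funenegE.
Qed.

Lemma Rintegral_affine (f : R -> R) a b : 0 < a ->
  mu.-integrable setT (EFin \o f) ->
  \int[mu]_x f x = a * \int[mu]_x f (a * x + b).
Proof.
move=> a0 fi; rewrite /Rintegral (integral_affine b a0 fi) fineM//.
exact: integrable_fin_num (integrable_affine b a0 fi).
Qed.

Lemma Rintegral_opp (f : R -> R) :
  mu.-integrable setT (EFin \o (f \o -%R)) -> measurable_fun setT f ->
  \int[mu]_x f x = \int[mu]_x f (- x).
Proof.
move=> fi mf; rewrite /Rintegral; congr fine.
rewrite (eq_measure_integral (pushforward mu (-%R : _ -> measurableTypeR R)))//.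
  by rewrite integral_pushforward//=; exact/measurable_EFinP.
by move=> A mA _; exact/esym/lebesgue_measureN.
Qed.
End affine.

(** * Functions of quadratic growth and exponential means *)

Section quadratic_growth.
Context {R : realType}.
Notation mu := (@lebesgue_measure R).
Implicit Types (a b c : R) (f g : R -> R).

(** Every deterministic function below is dominated by 1 + x^2, because the
    variance of an increment over a length x is |x|^{2H} with 2H < 2; this is
    integrable against all exponential laws. *)
Definition quad_growth f :=
  measurable_fun setT f /\ exists A, forall x, `|f x| <= A * (1 + x ^+ 2).

Lemma quad_growth_cst c : quad_growth (cst c).
Proof.
split=> //; exists `|c| => x; rewrite ler_peMr//.
by rewrite lerDl sqr_ge0.
Qed.

Lemma quad_growthD f g : quad_growth f -> quad_growth g ->
  quad_growth (fun x => f x + g x).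
Proof.
move=> [mf [A fA]] [mg [B gB]]; split; first exact: measurable_funD.
exists (A + B) => x; rewrite mulrDl (le_trans (ler_normD _ _))//.
exact: lerD.
Qed.

Lemma quad_growthZ c f : quad_growth f -> quad_growth (fun x => c * f x).
Proof.
move=> [mf [A fA]]; split; first exact: measurable_funM.
by exists (`|c| * A) => x; rewrite normrM -mulrA ler_wpM2l.
Qed.

Lemma quad_growthB f g : quad_growth f -> quad_growth g ->
  quad_growth (fun x => f x - g x).
Proof.
move=> qf qg; have := quad_growthD qf (quad_growthZ (-1) qg).
by under eq_fun do rewrite mulN1r.
Qed.

Lemma quad_growth_bound_ge0 (h A : R) (x : R) : `|h| <= A * (1 + x ^+ 2) -> 0 <= A.
Proof.
move=> hA; rewrite leNgt; apply/negP => A0.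
have : A * (1 + x ^+ 2) < 0 by rewrite nmulr_rlt0// ltr_wpDr// sqr_ge0.
by move=> /(le_lt_trans hA); rewrite normr_lt0.
Qed.

Lemma quad_growth_shift c f : quad_growth f -> quad_growth (fun x => f (c + x)).
Proof.
move=> [mf [A fA]]; split.
  by apply: measurableT_comp => //; exact: measurable_funD.
exists (A * (2 + 2 * c ^+ 2)) => x; apply: le_trans (fA _) _.
rewrite -mulrA ler_wpM2l ?(quad_growth_bound_ge0 (fA 0))//.
have := sqr_ge0 (c - x); have := mulr_ge0 (sqr_ge0 c) (sqr_ge0 x).
by rewrite !expr2; nra.
Qed.

Lemma quad_growth_opp f : quad_growth f -> quad_growth (fun x => f (- x)).
Proof.
move=> [mf [A fA]]; split; first exact: measurableT_comp.
by exists A => x; rewrite -[x ^+ 2]sqrrN.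
Qed.

Lemma quad_growth_reflect c f : quad_growth f -> quad_growth (fun x => f (c - x)).
Proof. by move=> /(quad_growth_shift c)/quad_growth_opp. Qed.

Lemma exp_ge_sqr (y : R) : 0 <= y -> y ^+ 2 / 4 <= expR y.
Proof.
move=> y0; have -> : y = y / 2 + y / 2 by lra.
rewrite expRD; have h := expR_ge1Dx (y / 2).
have h0 : 0 <= 1 + y / 2 by lra.
have := ler_pM h0 h0 h h; apply: le_trans; rewrite expr2; nra.
Qed.

(** Half of the exponential rate absorbs the quadratic factor. *)
Lemma exponential_pdf_sqr a (x : R) : 0 < a ->
  exponential_pdf a x * (1 + x ^+ 2) <=
  2 * (1 + 16 / a ^+ 2) * exponential_pdf (a / 2) x.
Proof.
move=> a0; have [x0|x0] := ltP x 0.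
  by rewrite !lt0_exponential_pdf// mul0r mulr0.
rewrite !exponential_pdfE//.
have -> : - a * x = - (a / 2) * x + - (a / 2) * x by lra.
rewrite expRD.
have e0 := expR_gt0 (- (a / 2) * x).
have eK : expR (- (a / 2) * x) * expR (a / 2 * x) = 1.
  by rewrite -expRD mulNr addNr expR0.
set u := expR _ in e0 eK *.
have y0 : 0 <= a / 2 * x by rewrite mulr_ge0// ltW// divr_gt0.
have h1 : 1 <= expR (a / 2 * x) by apply: le_trans (expR_ge1Dx _); rewrite lerDl.
have h2 := exp_ge_sqr y0.
set v := expR (a / 2 * x) in eK h1 h2 *.
have h3 : x ^+ 2 <= 16 / a ^+ 2 * v.
  rewrite -ler_pdivrMl ?divr_gt0 ?exprn_gt0//; apply: le_trans h2.
  by rewrite le_eqVlt; apply/orP; left; apply/eqP; field; rewrite gt_eqF.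
have h4 : 1 + x ^+ 2 <= (1 + 16 / a ^+ 2) * v by rewrite mulrDl mul1r lerD.
have -> : a * (u * u) * (1 + x ^+ 2) = (a * u * u) * (1 + x ^+ 2) by ring.
have au0 : 0 <= a * u * u by rewrite !mulr_ge0// ltW.
apply: le_trans (ler_wpM2l au0 h4) _.
rewrite le_eqVlt; apply/orP; left; apply/eqP.
transitivity (a * u * (1 + 16 / a ^+ 2) * (u * v)); first by ring.
by rewrite eK; field; rewrite gt_eqF.
Qed.

Lemma integrable_exponential_quad a f : 0 < a -> quad_growth f ->
  mu.-integrable setT (EFin \o (fun x => exponential_pdf a x * f x)).
Proof.
move=> a0 [mf [A fA]].
have a20 : 0 < a / 2 by rewrite divr_gt0.
have A0 := quad_growth_bound_ge0 (fA 0).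
pose c := A * (2 * (1 + 16 / a ^+ 2)).
apply: (@le_integrable _ _ _ mu _ _ _ (fun x => c%:E * (EFin \o exponential_pdf (a / 2)) x)%E) => //.
- apply/measurable_EFinP; apply: measurable_funM => //.
  exact: measurable_exponential_pdf.
- move=> x _ /=; rewrite lee_fin normrM.
  rewrite (ger0_norm (exponential_pdf_ge0 (ltW a0) _)).
  rewrite [leRHS]ger0_norm; last first.
    apply: mulr_ge0; last exact/exponential_pdf_ge0/ltW.
    by rewrite /c !mulr_ge0// addr_ge0// divr_ge0// sqr_ge0.
  apply: le_trans (ler_wpM2l (exponential_pdf_ge0 (ltW a0) _) (fA x)) _.
  rewrite mulrCA /c -mulrA ler_wpM2l//; exact: exponential_pdf_sqr.
- exact/integrableZl/integrable_exponential_pdf.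
Qed.

Definition exp_mean a f := \int[mu]_x (exponential_pdf a x * f x).

Lemma exp_mean_eq a f g : (forall x, 0 <= x -> f x = g x) ->
  exp_mean a f = exp_mean a g.
Proof.
move=> fg; apply: eq_Rintegral => x _; have [x0|x0] := ltP x 0.
  by rewrite !lt0_exponential_pdf// !mul0r.
by rewrite fg.
Qed.

Lemma exp_meanD a f g : 0 < a -> quad_growth f -> quad_growth g ->
  exp_mean a (fun x => f x + g x) = exp_mean a f + exp_mean a g.
Proof.
move=> a0 qf qg; rewrite /exp_mean; under eq_Rintegral do rewrite mulrDr.
by rewrite RintegralD//; exact: integrable_exponential_quad.
Qed.

Lemma exp_meanB a f g : 0 < a -> quad_growth f -> quad_growth g ->
  exp_mean a (fun x => f x - g x) = exp_mean a f - exp_mean a g.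
Proof.
move=> a0 qf qg; rewrite /exp_mean; under eq_Rintegral do rewrite mulrBr.
by rewrite RintegralB//; exact: integrable_exponential_quad.
Qed.

Lemma exp_meanZ a c f : 0 < a -> quad_growth f ->
  exp_mean a (fun x => c * f x) = c * exp_mean a f.
Proof.
move=> a0 qf; rewrite /exp_mean; under eq_Rintegral do rewrite mulrCA.
by rewrite RintegralZl//; exact: integrable_exponential_quad.
Qed.

Lemma exp_mean_cst a c : 0 < a -> exp_mean a (cst c) = c.
Proof.
move=> a0; rewrite /exp_mean RintegralZr//; last exact: integrable_exponential_pdf.
by rewrite /Rintegral integral_exponential_pdf//= mul1r.
Qed.

Lemma exp_mean_norm_le a f : 0 < a -> quad_growth f ->
  `|exp_mean a f| <= exp_mean a (fun x => `|f x|).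
Proof.
move=> a0 qf; apply: le_trans (le_normr_Rintegral _ _) _ => //.
  exact: integrable_exponential_quad.
under eq_Rintegral do rewrite normrM (ger0_norm (exponential_pdf_ge0 (ltW a0) _)).
exact: lexx.
Qed.

Lemma le_exp_mean a f g : 0 < a -> quad_growth f -> quad_growth g ->
  (forall x, f x <= g x) -> exp_mean a f <= exp_mean a g.
Proof.
move=> a0 qf qg fg; apply: le_Rintegral => //; try exact: integrable_exponential_quad.
by move=> x _; rewrite ler_wpM2l// exponential_pdf_ge0// ltW.
Qed.

Lemma quad_growth_norm f : quad_growth f -> quad_growth (fun x => `|f x|).
Proof.
move=> [mf [A fA]]; split; first exact: measurableT_comp.
by exists A => x; rewrite normr_id.
Qed.

Lemma quad_growth_sqr c : quad_growth (fun x => c * (1 + x ^+ 2)).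
Proof.
split; last by exists `|c| => x; rewrite normrM [X in _ * X]ger0_norm// addr_ge0// sqr_ge0.
by apply: measurable_funM => //; apply: measurable_funD => //; exact: measurable_funX.
Qed.
End quadratic_growth.

(** * Exponential laws: shift, decay, integrals singular at the origin *)

Section exponential_law.
Context {R : realType}.
Notation mu := (@lebesgue_measure R).
Implicit Types (a b c u : R) (f g h : R -> R).

(** Memorylessness, in the form needed to differentiate in [u]: on [u, oo[ the
    density is e^{-a u} times its translate, and the mean over [u, oo[ is the
    full mean minus an integral over [0, u]. *)
Lemma exp_mean_shift a u h : 0 < a -> 0 <= u -> quad_growth h ->
  exp_mean a (fun y => h (u + y)) = expR (a * u) *
    (exp_mean a h - \int[mu]_(z in `[0, u]) (exponential_pdf a z * h z)).
Proof.
move=> a0 u0 qh.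
have ih := integrable_exponential_quad a0 qh.
have ih' D : measurable D ->
    mu.-integrable D (EFin \o (fun x => exponential_pdf a x * h x)).
  by move=> mD; apply: integrableS ih.
rewrite /exp_mean (@Rintegral_affine _ _ 1 (- u))//; last first.
  exact: (integrable_exponential_quad a0 (quad_growth_shift u qh)).
rewrite mul1r.
have -> : \int[mu]_x (exponential_pdf a x * h x) =
    \int[mu]_(x in `[0, +oo[) (exponential_pdf a x * h x).
  rewrite [RHS]Rintegral_mkcond; apply: eq_Rintegral => x _; rewrite patchE.
  case: ifPn => //; rewrite notin_setE/= in_itv/= andbT => /negP; rewrite -ltNge => x0.
  by rewrite lt0_exponential_pdf// mul0r.
rewrite Rintegral_itvB//; last exact: ih'.
rewrite Rintegral_itv_obnd_cbnd; last exact: ih'.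
rewrite -RintegralZl//; last exact: ih'.
rewrite [RHS]Rintegral_mkcond; apply: eq_Rintegral => x _; rewrite patchE.
rewrite !mul1r (_ : u + (x - u) = x); last by rewrite addrC subrK.
case: ifPn.
  rewrite inE/= in_itv/= andbT => ux.
  rewrite !exponential_pdfE ?subr_ge0//; last exact: le_trans ux.
  rewrite mulrA [in RHS]mulrCA -expRD; congr (_ * expR _ * _).
  by ring.
rewrite notin_setE/= in_itv/= andbT => /negP; rewrite -ltNge => xu.
by rewrite lt0_exponential_pdf ?mul0r// subr_lt0.
Qed.

(** Memorylessness for a function which vanishes before time 0. *)
Lemma exp_mean_delay a u g : 0 < a -> 0 <= u -> quad_growth g ->
  (forall x, x < 0 -> g x = 0) ->
  exp_mean a (fun y => g (y - u)) = expR (- a * u) * exp_mean a g.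
Proof.
move=> a0 u0 qg g0.
have ig := integrable_exponential_quad a0 qg.
rewrite /exp_mean (@Rintegral_affine _ _ 1 u)//; last first.
  have := integrable_exponential_quad a0 (quad_growth_shift (- u) qg).
  by under eq_fun do rewrite [- u + _]addrC.
rewrite mul1r -RintegralZl//; apply: eq_Rintegral => x _.
rewrite !mul1r addrK; have [x0|x0] := ltP x 0; first by rewrite g0// !mulr0.
rewrite !exponential_pdfE//; last exact: addr_ge0.
by rewrite mulrA [in RHS]mulrCA -expRD; congr (_ * expR _ * _); ring.
Qed.

Lemma expR_decay a : 0 < a -> expR (- a * x) @[x --> +oo%R] --> (0 : R).
Proof.
move=> a0; under eq_fun do rewrite mulNr.
apply: (@cvg_comp _ _ _ (fun x => a * x) (fun z => expR (- z)) _ (pinfty_nbhs R)).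
  exact: gt0_cvgMry.
exact: cvgr_expR.
Qed.

Lemma expR_quad_decay a f (A : R) : 0 < a ->
  (forall x, 1 <= x -> `|f x| <= A * (1 + x ^+ 2)) ->
  expR (- a * x) * f x @[x --> +oo%R] --> (0 : R).
Proof.
move=> a0 fA.
have A0 : 0 <= A by exact: quad_growth_bound_ge0 (fA 1 (lexx _)).
have a20 : 0 < a / 2 by rewrite divr_gt0.
apply: norm_cvg0; pose c := A * (1 + 16 / a ^+ 2).
apply: (@squeeze_cvgr _ _ _ _ (cst 0) (fun x => c * expR (- (a / 2) * x))); last 2 first.
- exact: cvg_cst.
- by rewrite -(mulr0 c); apply: cvgM; [exact: cvg_cst|exact: expR_decay].
near=> x; rewrite normr_ge0/= normrM (ger0_norm (expR_ge0 _)).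
have x1 : 1 <= x by near: x; exact: nbhs_pinfty_ge.
have x0 : 0 <= x by exact: le_trans x1.
have := exponential_pdf_sqr x a0; rewrite !exponential_pdfE// => h.
apply: le_trans (ler_wpM2l (expR_ge0 _) (fA x x1)) _.
rewrite mulrCA /c -mulrA ler_wpM2l// -(ler_pM2l a0) mulrA.
by apply: le_trans h _; rewrite le_eqVlt; apply/orP; left; apply/eqP; field;
  rewrite gt_eqF.
Unshelve. all: by end_near. Qed.

(** [f] may blow up at 0, so the fundamental theorem of calculus is used on
    [e n, T] and the endpoint e n is sent to 0 by monotone convergence. *)
Lemma ge0_FTC2_open0 f (F : R -> R) (T : R) : 0 < T ->
  (forall x : R, 0 < x -> 0 <= f x) ->
  (forall x : R, 0 < x -> {for x, continuous f}) ->
  (forall x : R, 0 < x -> is_derive x 1 F (f x)) ->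
  F x @[x --> 0^'+] --> F 0 ->
  (\int[mu]_(x in `[0%R, T]) (f x)%:E = (F T - F 0)%R%:E)%E.
Proof.
move=> T0 f0 cf dF F0.
pose e (n : nat) : R := T / n.+2%:R.
have e0 n : 0 < e n by rewrite divr_gt0.
have eT n : e n < T by rewrite ltr_pdivrMr// ltr_pMr// ltr1n.
have e_dec n m : (n <= m)%N -> e m <= e n.
  by move=> nm; rewrite /e ler_pM2l// lef_pV2 ?posrE// ler_nat.
have cvge : e n @[n --> \oo] --> (0 : R).
  rewrite -(mulr0 T); apply: cvgM; first exact: cvg_cst.
  by rewrite (cvg_shiftS (fun n => (n.+1%:R : R)^-1)); exact: cvg_harmonic.
have mf (D : set R) : D `<=` [set x : R | 0 < x] -> measurable D -> measurable_fun D (EFin \o f).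
  move=> DD mD; apply/measurable_EFinP.
  apply: (@measurable_funS _ _ _ _ [set x : R | 0 < x]) => //.
    by rewrite -set_itvoy; exact: measurable_itv.
  apply: open_continuous_measurable_fun; first by rewrite -set_itvoy; exact: interval_open.
  by move=> x; rewrite inE; exact: cf.
have sub0T : `]0, T]%classic `<=` [set x : R | 0 < x].
  by move=> x/=; rewrite in_itv/= => /andP[].
rewrite -integral_itv_obnd_cbnd; last by apply: (mf `]0, T]%classic).
have -> : `]0, T]%classic = \bigcup_n `[e n, T]%classic.
  apply/seteqP; split=> [x/=|x [n _]/=]; rewrite !in_itv/=.
    move=> /andP[x0 xT].
    have : \forall n \near \oo, e n < x by exact: (cvgr_lt (0 : R)).
    by move=> [N _ /(_ N (leqnn N)) eNx]; exists N => //=; rewrite in_itv/= (ltW eNx).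
  by move=> /andP[enx xT]; rewrite xT andbT (lt_le_trans (e0 n)).
apply/esym; apply: cvg_unique (ge0_nondecreasing_set_cvg_integral _ _ _ _); last 4 first.
- move=> n m nm; apply/subsetPset => x/=; rewrite !in_itv/= => /andP[h ->].
  by rewrite (le_trans (e_dec _ _ nm)).
- by move=> i; exact: measurable_itv.
- move=> i; apply: mf => // x/=; rewrite in_itv/= => /andP[h _].
  exact: lt_le_trans h.
- move=> i x/=; rewrite in_itv/= => /andP[h _]; rewrite lee_fin f0//.
  exact: lt_le_trans h.
- exact: ereal_hausdorff.
rewrite (_ : (fun i => _) = (fun n => (F T - F (e n))%:E)); last first.
  apply/funext => n.
  have cF x : 0 < x -> {for x, continuous F}.
    move=> x0; apply: differentiable_continuous; apply/derivable1_diffP.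
    by case: (dF x x0).
  rewrite (@continuous_FTC2 _ f F)//.
  - apply: continuous_in_subspaceT => x; rewrite inE/= in_itv/= => /andP[h _].
    by apply: cf; exact: lt_le_trans h.
  - split.
    + move=> x; rewrite in_itv/= => /andP[h _].
      by case: (dF x (lt_trans (e0 n) h)).
    + exact/cvg_at_right_filter/cF.
    + exact/cvg_at_left_filter/cF.
  - move=> x; rewrite in_itv/= => /andP[h _]; rewrite derive1E.
    by case: (dF x (lt_trans (e0 n) h)).
apply: cvg_EFin; first by near=> n.
apply: cvgB; first exact: cvg_cst.
apply: (cvg_at_rightP _ _ _).1 => //.
Unshelve. all: by end_near. Qed.

End exponential_law.

(** * Derivatives and parametrized integrals *)

Section derive_helpers.
Context {R : realType}.
Notation mu := (@lebesgue_measure R).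
Implicit Types (c : R).

Lemma is_derive_expRM c (x : R) :
  is_derive x (1 : R) (fun u => expR (c * u)) (c * expR (c * x)).
Proof.
have h : is_derive x (1 : R) (fun u => c * u) c.
  by apply: is_derive_eq; rewrite !scaler1.
have := @is_derive1_comp R expR (fun u => c * u) x (expR (c * x)) c.
by rewrite [c * expR _]mulrC; apply; exact: is_derive_expR.
Qed.

Lemma is_derive_continuous (f : R -> R) (x l : R) :
  is_derive x (1 : R) f l -> {for x, continuous f}.
Proof.
by move=> [fx _]; apply: differentiable_continuous; apply/derivable1_diffP.
Qed.

Lemma is_derive_shift_arg (f : R -> R) (c x l : R) :
  is_derive (c + x) (1 : R) f l -> is_derive x (1 : R) (fun u => f (c + u)) l.
Proof.
move=> h.
have h1 : is_derive x (1 : R) (fun u => c + u) 1.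
  have := is_deriveD (is_derive_cst c x (1 : R)) (is_derive_id x (1 : R)).
  by rewrite add0r.
have := @is_derive1_comp R f (fun u => c + u) x l 1.
by rewrite mulr1; apply.
Qed.

Lemma integral_itv_reflect (f : R -> R) (T : R) :
  mu.-integrable `[0, T] (EFin \o f) ->
  \int[mu]_(x in `[0, T]) f (T - x) = \int[mu]_(x in `[0, T]) f x.
Proof.
move=> fi.
have fiT : mu.-integrable setT (EFin \o (f \_ `[0, T])).
  by rewrite -restrict_EFin; exact/(integrable_mkcond _ _).1.
have mfE := measurable_int mu fiT.
have mfT : measurable_fun setT (f \_ `[0, T]).
  by move/measurable_EFinP : (measurable_int mu fiT).
have fiN : mu.-integrable setT (EFin \o ((f \_ `[0, T]) \o -%R)).
  apply/integrableP; split; first by apply/measurable_EFinP; exact: measurableT_comp.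
  move/integrableP : fiT => [_].
  rewrite (eq_measure_integral (pushforward mu (-%R : _ -> measurableTypeR R)))//; last first.
    by move=> A mA _; exact/esym/lebesgue_measureN.
  rewrite ge0_integral_pushforward//=.
  have := measurableT_comp (@abse_measurable R setT) mfE; exact.
rewrite [RHS]Rintegral_mkcond [LHS]Rintegral_mkcond [RHS]Rintegral_opp//.
rewrite [RHS](Rintegral_affine (- T) ltr01)//.
rewrite mul1r; apply: eq_Rintegral => x _; rewrite mul1r opprB !patchE.
suff -> : (x \in `[0, T]%classic) = (T - x \in `[0, T]%classic) by [].
by apply/idP/idP; rewrite !inE/= !in_itv/= => /andP[? ?]; apply/andP; split; lra.
Qed.

(** Tonelli applies to the positive and to the negative part; the integral is the
    difference of two measurable functions. *)
Lemma measurable_Rintegral_param d1 d2 (T1 : measurableType d1)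
    (T2 : measurableType d2) (m : {sigma_finite_measure set T2 -> \bar R})
    (f : T1 * T2 -> R) : measurable_fun setT f ->
  measurable_fun setT (fun s => \int[m]_y f (s, y)).
Proof.
move=> mf; apply: measurableT_comp => //.
under eq_fun do rewrite integralE.
have mF : measurable_fun setT (EFin \o f) by exact/measurable_EFinP.
apply: emeasurable_funB.
  have := @measurable_fun_fubini_tonelli_F _ _ _ _ _ m _ (measurable_funepos mF).
  move=> /(_ (funepos_ge0 _)); apply: eq_measurable_fun => x _.
  by apply: eq_integral => y _; rewrite !funeposE.
have := @measurable_fun_fubini_tonelli_F _ _ _ _ _ m _ (measurable_funeneg mF).
move=> /(_ (funeneg_ge0 _)); apply: eq_measurable_fun => x _.
by apply: eq_integral => y _; rewrite !funenegE.
Qed.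

Lemma integrable_prod_bound d1 d2 (T1 : measurableType d1)
    (T2 : measurableType d2) (m1 : {sigma_finite_measure set T1 -> \bar R})
    (m2 : {sigma_finite_measure set T2 -> \bar R})
    (f : T1 * T2 -> R) (g1 : T1 -> R) (g2 : T2 -> R) :
  measurable_fun setT f ->
  m1.-integrable setT (EFin \o g1) -> m2.-integrable setT (EFin \o g2) ->
  (forall s y, `|f (s, y)| <= g1 s * g2 y) ->
  (m1 \x m2)%E.-integrable setT (EFin \o f).
Proof.
move=> mf g1i g2i fg.
have mg1 : measurable_fun setT g1 by move/measurable_EFinP : (measurable_int m1 g1i).
have mg2 : measurable_fun setT g2 by move/measurable_EFinP : (measurable_int m2 g2i).
apply/integrable12ltyP; first exact/measurable_EFinP.
set G := (\int[m2]_y (`|g2 y|)%:E)%E.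
have Gfin : G \is a fin_num.
  by rewrite ge0_fin_numE ?integral_ge0//; case/integrableP : g2i.
apply: (@le_lt_trans _ _ (\int[m1]_x ((`|g1 x|)%:E * G))%E).
  apply: ge0_le_integral => //.
  - by move=> x _; exact: integral_ge0.
  - have mf' : measurable_fun setT (fun z => `|(EFin \o f) z|%E).
      by apply: measurableT_comp => //; exact/measurable_EFinP.
    exact: (@measurable_fun_fubini_tonelli_F _ _ _ _ _ m2 _ mf' (fun=> abse_ge0 _)).
  - by apply: emeasurable_funM => //; apply/measurable_EFinP; exact: measurableT_comp.
  - move=> x _; rewrite /G -ge0_integralZl//; last first.
      by apply/measurable_EFinP; exact: measurableT_comp.
    apply: ge0_le_integral => //.
    + apply/measurable_EFinP/measurableT_comp => //.
      exact: (measurableT_comp mf (pair1_measurable x)).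
    + by apply/measurable_EFinP; apply: measurable_funM => //; exact: measurableT_comp.
    + move=> y _; rewrite /= lee_fin -normrM.
      exact: le_trans (fg x y) (ler_norm _).
rewrite ge0_integralZr//; last 2 first.
- by apply/measurable_EFinP; exact: measurableT_comp.
- exact: integral_ge0.
rewrite lte_mul_pinfty//; first exact: integral_ge0.
  by rewrite ge0_fin_numE ?integral_ge0//; case/integrableP : g1i.
by rewrite -ge0_fin_numE ?integral_ge0.
Qed.
End derive_helpers.

(** * The covariance of two exponential filters as a function of the lag *)

Section kernel.
Context {R : realType}.
Notation mu := (@lebesgue_measure R).
Variables (k k1 : R -> R) (kappa h a b : R).
Hypotheses (a0 : 0 < a) (b0 : 0 < b).
Hypothesis qk : quad_growth k.
Hypothesis kr : k x @[x --> 0^'+] --> k 0.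
Hypothesis dk : forall x : R, 0 < x -> is_derive x 1 k (k1 x).
Hypothesis dk1 : forall x : R, 0 < x -> is_derive x 1 k1 (- kappa * x `^ (h - 2)).
Hypothesis gk1 : exists A, forall x, 1 <= x -> `|k1 x| <= A * (1 + x ^+ 2).

(** Up to terms cancelling in [stat_cov], the covariance between the first
    process unfiltered and the second one filtered at rate [b], as a function
    of the lag. *)
Definition half_cov u := exp_mean b (fun y => k u - k (u + y)).
Local Notation D := half_cov.

(** The covariance, for unit [nu], of two processes filtered at rates [a] and
    [b], at lag [tau]. *)
Definition stat_cov tau := exp_mean a (fun x => exp_mean b (fun y =>
  k tau - k (tau - x) - k (tau + y) + k (tau - x + y))).
Local Notation C := stat_cov.

Lemma half_covE u : D u = k u - exp_mean b (fun y => k (u + y)).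
Proof.
rewrite /half_cov exp_meanB ?exp_mean_cst//; first exact: quad_growth_cst.
exact: quad_growth_shift.
Qed.

Lemma quad_growth_half_cov : quad_growth D.
Proof.
have [mk [A kA]] := qk.
split.
  apply: (@measurable_Rintegral_param _ _ _ _ _ mu
    (fun z : R * R => exponential_pdf b z.2 * (k z.1 - k (z.1 + z.2)))).
  apply: measurable_funM.
    by apply: measurableT_comp => //; exact: measurable_exponential_pdf.
  apply: measurable_funB; first exact: measurableT_comp.
  by apply: measurableT_comp => //; exact: measurable_funD.
have A0 := quad_growth_bound_ge0 (kA 0).
exists (4 * A * exp_mean b (fun y => 1 * (1 + y ^+ 2))) => u.
have q1 : quad_growth (fun y => k u - k (u + y)).
  by apply: quad_growthB; [exact: quad_growth_cst|exact: quad_growth_shift].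
apply: le_trans (exp_mean_norm_le b0 q1) _.
have -> : 4 * A * exp_mean b (fun y => 1 * (1 + y ^+ 2)) * (1 + u ^+ 2) =
    exp_mean b (fun y => (4 * A * (1 + u ^+ 2)) * (1 * (1 + y ^+ 2))).
  rewrite [RHS]exp_meanZ//; last exact: quad_growth_sqr.
  by ring.
apply: le_exp_mean => //; first exact: quad_growth_norm.
  exact/quad_growthZ/quad_growth_sqr.
move=> y; apply: le_trans (ler_normB _ _) _.
apply: le_trans (lerD (kA u) (kA (u + y))) _.
rewrite -mulrDr -!mulrA [leRHS]mulrCA ler_wpM2l// mul1r.
have := sqr_ge0 (u - y); have := mulr_ge0 (sqr_ge0 u) (sqr_ge0 y).
have := sqr_ge0 y; rewrite !expr2; nra.
Qed.

(** On [0, oo[ the shift formula gives [half_cov] the closed form [Dp], whose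
    derivative is e^{b u} q(u) with q' = e^{-b u} k''. *)
Let M := exp_mean b k.
Let W u := \int[mu]_(z in `[0, u]) (exponential_pdf b z * k z).
Let Dp u := k u - expR (b * u) * (M - W u).

Lemma half_cov_Dp u : 0 <= u -> D u = Dp u.
Proof. by move=> u0; rewrite half_covE exp_mean_shift. Qed.

Let itv0_exp (f : R -> R) (c u : R) : 0 < c -> quad_growth f ->
  mu.-integrable `[0, u] (EFin \o (fun x => exponential_pdf c x * f x)).
Proof.
by move=> c0 qf; apply: integrableS (integrable_exponential_quad c0 qf).
Qed.

Lemma is_derive_itv0 (f : R -> R) (x : R) : 0 < x ->
  (forall u, mu.-integrable `[0, u] (EFin \o f)) ->
  {for x, continuous f} ->
  is_derive x 1 (fun u => \int[mu]_(z in `[0, u]) f z) (f x).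
Proof.
move=> x0 fi cf.
have x1 : x < x + 1 by rewrite ltrDl.
have [d e] := continuous_FTC1_closed x1 (fi _) x0 cf.
by split; [exact: d|rewrite -derive1E; exact: e].
Qed.

Lemma continuous_exponential_pdf_gt0 (c x : R) : 0 < x ->
  {for x, continuous (exponential_pdf c)}.
Proof.
by move=> x0; apply: in_continuous_exponential_pdf; rewrite in_itv/= x0.
Qed.

Let dW (x : R) : 0 < x -> is_derive x 1 W (b * expR (- b * x) * k x).
Proof.
move=> x0; rewrite -exponential_pdfE ?ltW//.
apply: (@is_derive_itv0 (fun z => exponential_pdf b z * k z)) => //.
- by move=> u; exact: itv0_exp.
- apply: continuousM; first exact: continuous_exponential_pdf_gt0.
  exact: is_derive_continuous (dk x0).
Qed.

Let q u := expR (- b * u) * k1 u + b * (expR (- b * u) * Dp u).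

Let dDp (x : R) : 0 < x -> is_derive x 1 Dp (expR (b * x) * q x).
Proof.
move=> x0; have h1 := dk x0; have h2 := dW x0; have h3 := is_derive_expRM b x.
apply: is_derive_eq.
have E : expR (b * x) * expR (- b * x) = 1 by rewrite -expRD mulNr addrN expR0.
rewrite /q /Dp; set e1 := expR (b * x) in E *; set e2 := expR (- b * x) in E *.
rewrite /GRing.scale/=.
have -> : e1 * (e2 * k1 x + b * (e2 * (k x - e1 * (M - W x)))) =
  (e1 * e2) * k1 x + (e1 * e2) * b * (k x - e1 * (M - W x)) by ring.
rewrite E.
have -> : e1 * ((0 + 1) * - (b * e2 * k x)) = - (e1 * e2) * b * k x by ring.
by rewrite E; ring.
Qed.

Let dq (x : R) : 0 < x -> is_derive x 1 q (expR (- b * x) * (- kappa * x `^ (h - 2))).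
Proof.
move=> x0; have h1 := dk1 x0; have h2 := dDp x0; have h3 := is_derive_expRM (- b) x.
apply: is_derive_eq.
have E : expR (b * x) * expR (- b * x) = 1 by rewrite -expRD mulNr addrN expR0.
rewrite /q; set e1 := expR (b * x) in E *; set e2 := expR (- b * x) in E *.
rewrite /GRing.scale/=.
set d := Dp x; set p := x `^ (h - 2).
have -> : e2 * (e1 * (e2 * k1 x + b * (e2 * d))) = (e1 * e2) * (e2 * k1 x + b * (e2 * d)).
  by ring.
by rewrite E; ring.
Qed.

(** This is what fixes the constant of integration of [q]. *)
Let q_cvg0 : q x @[x --> +oo%R] --> (0 : R).
Proof.
have [A k1A] := gk1.
rewrite -(addr0 0); apply: cvgD; first exact: expR_quad_decay b0 k1A.
rewrite -(mulr0 b); apply: cvgM; first exact: cvg_cst.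
have [_ [B DB]] := quad_growth_half_cov.
apply: expR_quad_decay => // x x1; rewrite -half_cov_Dp; first exact: DB.
exact: le_trans x1.
Qed.

(** The inner integral of [mfOU_I]. *)
Let inner u := \int[mu]_(v in `]-oo, 0]) (expR (b * v) * (u - v) `^ (h - 2)).

Let inner_reflect u :
  inner u = \int[mu]_(y in `[0, +oo[) (expR (- b * y) * (u + y) `^ (h - 2)).
Proof.
rewrite /inner /Rintegral; apply: (congr1 fine).
rewrite (@ge0_integration_by_substitution0 R
  (fun y => (expR (- b * y) * (u + y) `^ (h - 2))%:E)).
- by apply: eq_integral => v _; rewrite mulrNN.
- apply/measurable_EFinP; apply: measurable_funM.
    by apply: measurableT_comp => //; exact: measurable_funM.
  exact: (measurableT_comp (measurable_powR (h - 2))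
    (measurable_funD (measurable_cst u) (@measurable_id _ _ setT))).
- by move=> r; rewrite lee_fin mulr_ge0 ?expR_ge0 ?powR_ge0.
Qed.

(** After v = -y the integrand on the left, times [kappa], is -e^{b u} q'(u + y),
    and [q] vanishes at infinity. *)
Let kernel_inner u : 0 < u -> kappa * inner u = expR (b * u) * q u.
Proof.
move=> u0; rewrite inner_reflect.
pose f y := expR (- b * y) * (u + y) `^ (h - 2).
have f0 y : 0 <= f y by rewrite mulr_ge0 ?expR_ge0 ?powR_ge0.
have cq (x : R) : 0 < x -> {for x, continuous q}.
  by move=> x0; exact: is_derive_continuous (dq x0).
have ftc (c : R) (g : R -> R) : (forall y, 0 <= g y) ->
    {within `[0, +oo[, continuous g} ->
    (forall y, 0 <= y -> - c * kappa * expR (- b * u) * f y = g y) ->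
    \int[mu]_(y in `[0, +oo[) g y = - (c * q u).
  move=> g0 cg cfg.
  have dF (y : R) : 0 <= y -> is_derive y 1 (fun y => c * q (u + y)) (g y).
    move=> y0; rewrite -(cfg y y0).
    have uy0 : 0 < u + y by rewrite ltr_wpDr.
    have dqy := is_derive_shift_arg (dq uy0).
    apply: is_derive_eq; rewrite /GRing.scale/= /f.
    have -> : - b * (u + y) = - b * u + - b * y by ring.
    by rewrite expRD; ring.
  have cF : (fun y => c * q (u + y)) @ +oo --> (0 : R).
    rewrite -(mulr0 c); apply: cvgM; first exact: cvg_cst.
    apply: (@cvg_comp _ _ _ (fun y => u + y) q _ (pinfty_nbhs R)) => //.
    exact: cvg_addrl.
  have cF0 : (fun y => c * q (u + y)) @ 0^'+ --> c * q (u + 0).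
    by apply/cvg_at_right_filter; exact: is_derive_continuous (dF 0 (lexx _)).
  have := @Rintegral_ge0_continuous_FTC2y _ g (fun y => c * q (u + y)) 0 0
    (fun y _ => g0 y) cg cF.
  rewrite addr0 sub0r; apply.
  - by move=> y y0; case: (dF y (ltW y0)).
  - by rewrite addr0 in cF0.
  - by move=> y; rewrite in_itv/= andbT => y0; rewrite derive1E; case: (dF y (ltW y0)).
have [k00|kn0] := eqVneq kappa 0.
  have : \int[mu]_(y in `[0, +oo[) cst (0 : R) y = - (1 * q u).
    apply: ftc => //; first by apply: continuous_subspaceT => ?; exact: cvg_cst.
    by move=> y _; rewrite k00 mulr0 !mul0r.
  rewrite Rintegral_cst// mul0r mul1r k00 mul0r => /eqP.
  by rewrite eq_sym oppr_eq0 => /eqP ->; rewrite mulr0.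
rewrite (ftc (- (expR (b * u) / kappa)) f) => //.
- by rewrite mulNr opprK; field.
- apply: continuous_in_subspaceT => y; rewrite inE/= in_itv/= andbT => y0.
  have uy0 : 0 < u + y by rewrite ltr_wpDr.
  rewrite /f; apply: (@continuousM _ _ (fun y => expR (- b * y)) (fun y => (u + y) `^ (h - 2))).
    exact: is_derive_continuous (is_derive_expRM _ _).
  apply: (@continuous_comp _ _ _ (fun y => u + y) (fun z => z `^ (h - 2))).
    by apply: cvgD; [exact: cvg_cst|exact: cvg_id].
  exact: is_derive_continuous (is_derive1_powR _ uy0).
- move=> y _.
  have E : expR (b * u) * expR (- b * u) = 1 by rewrite -expRD mulNr addrN expR0.
  rewrite opprK; transitivity ((expR (b * u) * expR (- b * u)) * f y).
    by field.
  by rewrite E mul1r.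
Qed.

Let Dp0 : Dp x @[x --> 0^'+] --> Dp 0.
Proof.
have W0 : W 0 = 0 by rewrite /W set_itv1 Rintegral_set1.
apply: cvgB; first exact: kr.
apply: cvgM.
  by apply/cvg_at_right_filter; exact: is_derive_continuous (is_derive_expRM _ _).
apply: cvgB; first exact: cvg_cst.
rewrite W0; apply: cvg_at_right_filter.
exact: (parameterized_integral_cvg_left ltr01 (itv0_exp _ b0 qk)).
Qed.

Let Dp_itv u : mu.-integrable `[0, u] (EFin \o (fun z => a * expR (a * z) * Dp z)).
Proof.
have [mD [A DA]] := quad_growth_half_cov; have A0 := quad_growth_bound_ge0 (DA 0).
have me : measurable_fun setT (fun z : R => a * expR (a * z)).
  by apply: measurable_funM => //; apply: measurableT_comp => //; exact: measurable_funM.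
apply: (@eq_integrable _ _ _ mu _ _ (EFin \o (fun z => a * expR (a * z) * D z))) => //.
  by move=> z; rewrite inE/= in_itv/= => /andP[z0 _]; rewrite half_cov_Dp.
apply: (@le_integrable _ _ _ mu _ _ _ (fun=> (a * expR (a * u) * (A * (1 + u ^+ 2)))%:E)) => //.
- exact/measurable_EFinP/measurable_funTS/measurable_funM.
- move=> z; rewrite /= in_itv/= => /andP[z0 zu]; rewrite lee_fin.
  rewrite [leRHS]ger0_norm; last first.
    by rewrite !mulr_ge0 ?expR_ge0 ?addr_ge0 ?sqr_ge0// ltW.
  rewrite normrM ler_pM//.
    rewrite ger0_norm ?mulr_ge0 ?expR_ge0 ?(ltW a0)//.
    by rewrite ler_pM2l// ler_expR ler_pM2l.
  by apply: le_trans (DA z) _; rewrite ler_wpM2l// lerD2l lerXn2r// nnegrE// (le_trans z0).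
- apply/integrableP; split => //.
  rewrite integral_cst//= lebesgue_measure_itv/=.
  by case: ifPn => _; rewrite ?mule0// -EFinB -EFinM ltry.
Qed.

(** [Psi] is e^{a t} stat_cov(t) - stat_cov(0), see [stat_cov_Psi]; it solves
    Psi' = kappa e^{a t} inner(t) and vanishes at 0. *)
Let Psi t := expR (a * t) * Dp t - Dp 0 -
  \int[mu]_(u in `[0, t]) (a * expR (a * u) * Dp u).

Let dPsi (x : R) : 0 < x -> is_derive x 1 Psi (expR (a * x) * (kappa * inner x)).
Proof.
move=> x0; have h1 := is_derive_expRM a x; have h2 := dDp x0.
have h3 : is_derive x 1 (fun t => \int[mu]_(u in `[0, t]) (a * expR (a * u) * Dp u))
    (a * expR (a * x) * Dp x).
  apply: (@is_derive_itv0 (fun z => a * expR (a * z) * Dp z)) => //.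
  apply: (@continuousM _ _ (fun z => a * expR (a * z)) Dp).
    apply: (@continuousM _ _ (fun=> a) (fun z => expR (a * z))); first exact: cvg_cst.
    exact: is_derive_continuous h1.
  exact: is_derive_continuous h2.
apply: is_derive_eq; rewrite kernel_inner// /GRing.scale/=.
by ring.
Qed.

Let Psi0 : Psi x @[x --> 0^'+] --> Psi 0.
Proof.
apply: cvgB.
  apply: cvgB; last exact: cvg_cst.
  apply: cvgM; last exact: Dp0.
  by apply/cvg_at_right_filter; exact: is_derive_continuous (is_derive_expRM _ _).
rewrite set_itv1 Rintegral_set1; apply: cvg_at_right_filter.
exact: (parameterized_integral_cvg_left ltr01 (Dp_itv _)).
Qed.

Let Psi00 : Psi 0 = 0.
Proof. by rewrite /Psi mulr0 expR0 mul1r set_itv1 Rintegral_set1 subr0 subrr. Qed.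

Let kernel_Psi t : 0 < t -> kappa * mfOU_I h a b t = Psi t.
Proof.
move=> t0; have [k00|kn0] := eqVneq kappa 0.
  have : (\int[mu]_(x in `[0%R, t]) (cst (0 : R) x)%:E = (Psi t - Psi 0)%R%:E)%E.
    apply: (@ge0_FTC2_open0 _ (cst 0) Psi t t0) => [x _|x _|x x0|].
    - exact: lexx.
    - exact: cvg_cst.
    - by have := dPsi x0; rewrite k00 mul0r mulr0; exact.
    - exact: Psi0.
  by rewrite integral0 Psi00 subr0 k00 mul0r => -[->].
pose f u := expR (a * u) * inner u.
pose g u := expR (a * u) * (expR (b * u) * q u / kappa).
have fg u : 0 < u -> f u = g u.
  by move=> u0; rewrite /f /g -kernel_inner// [kappa * _]mulrC mulfK.
have : (\int[mu]_(x in `[0%R, t]) (f x)%:E =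
    ((fun x => kappa^-1 * Psi x) t - (fun x => kappa^-1 * Psi x) 0)%R%:E)%E.
  apply: (@ge0_FTC2_open0 _ f (fun x => kappa^-1 * Psi x) t t0).
  - move=> x _; apply: mulr_ge0; first exact: expR_ge0.
    by apply: Rintegral_ge0 => v _; rewrite mulr_ge0 ?expR_ge0 ?powR_ge0.
  - move=> x x0.
    have cg : {for x, continuous g}.
      apply: (@continuousM _ _ (fun u => expR (a * u)) (fun u => expR (b * u) * q u / kappa)).
        exact: is_derive_continuous (is_derive_expRM _ _).
      apply: (@continuousM _ _ (fun u => expR (b * u) * q u) (fun=> kappa^-1)); last exact: cvg_cst.
      apply: (@continuousM _ _ (fun u => expR (b * u)) q).
        exact: is_derive_continuous (is_derive_expRM _ _).
      exact: is_derive_continuous (dq x0).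
    have {}cg : g z @[z --> x] --> f x by rewrite fg//; exact: cg.
    apply: cvg_trans cg; apply: near_eq_cvg.
    near=> z; apply/esym/fg; near: z; exact: lt_nbhsr.
  - move=> x x0; have := dPsi x0 => dP.
    by apply: is_derive_eq; rewrite /GRing.scale/= /f; field.
  - by apply: cvgM; [exact: cvg_cst|exact: Psi0].
rewrite /= Psi00 mulr0 subr0 => E.
by rewrite /mfOU_I {1}/Rintegral E/= mulrA mulfV// mul1r.
Unshelve. all: by end_near. Qed.

(** Filtering twice is filtering [half_cov] once more. *)
Lemma stat_covE tau : C tau = D tau - exp_mean a (fun x => D (tau - x)).
Proof.
rewrite -(exp_mean_cst (D tau) a0) -exp_meanB//; last 2 first.
- exact: quad_growth_cst.
- exact: quad_growth_reflect quad_growth_half_cov.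
apply: exp_mean_eq => x _; rewrite /half_cov -exp_meanB//; last 2 first.
- by apply: quad_growthB; [exact: quad_growth_cst|exact: quad_growth_shift].
- by apply: quad_growthB; [exact: quad_growth_cst|exact: quad_growth_shift].
by apply: exp_mean_eq => y _; ring.
Qed.

Let stat_cov_Psi t : 0 < t -> expR (a * t) * C t - C 0 = Psi t.
Proof.
move=> t0; have qD := quad_growth_half_cov.
rewrite !stat_covE.
have -> : exp_mean a (fun x => D (0 - x)) = exp_mean a (fun x => D (t - (t + x))).
  by apply: exp_mean_eq => x _; congr half_cov; ring.
rewrite (exp_mean_shift a0 (ltW t0) (quad_growth_reflect t qD)).
rewrite /Psi -!half_cov_Dp ?(ltW t0)//.
have -> : \int[mu]_(u in `[0, t]) (a * expR (a * u) * Dp u) =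
    expR (a * t) * \int[mu]_(z in `[0, t]) (exponential_pdf a z * D (t - z)).
  rewrite -RintegralZl//; last first.
    exact: (itv0_exp _ a0 (quad_growth_reflect t qD)).
  rewrite -integral_itv_reflect; last exact: Dp_itv.
  apply: eq_Rintegral => x; rewrite inE/= in_itv/= => /andP[x0 xt].
  rewrite exponential_pdfE// -half_cov_Dp ?subr_ge0// mulrA [in RHS]mulrCA -expRD.
  by congr (_ * expR _ * _); ring.
by ring.
Qed.

Theorem stat_cov_integral t : 0 < t ->
  C t = expR (- a * t) * C 0 + expR (- a * t) * (kappa * mfOU_I h a b t).
Proof.
move=> t0; rewrite kernel_Psi// -stat_cov_Psi// -mulrDr addrC subrK mulrA.
by rewrite -expRD mulNr addNr expR0 mul1r.
Qed.
End kernel.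

(** * The covariance at lag zero *)

Section cov_at_zero.
Context {R : realType}.
Notation mu := (@lebesgue_measure R).
Implicit Types (a b : R) (k : R -> R).

Lemma exp_mean_iterE a b (F : R * R -> R) : 0 < b ->
  (forall x, quad_growth (fun y => F (x, y))) ->
  exp_mean a (fun x => exp_mean b (fun y => F (x, y))) =
  fine (\int[mu]_x \int[mu]_y
    (exponential_pdf a x * exponential_pdf b y * F (x, y))%:E)%E.
Proof.
move=> b0 qF; rewrite /exp_mean {1}/Rintegral; apply: (congr1 fine).
apply: eq_integral => x _.
have i := integrable_exponential_quad b0 (qF x).
rewrite EFinM /Rintegral fineK; last exact: integrable_fin_num.
rewrite -integralZl//; apply: eq_integral => y _.
by rewrite -EFinM mulrA.
Qed.

Lemma exp_mean_swap a b (F : R * R -> R) (A : R) : 0 < a -> 0 < b ->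
  measurable_fun setT F ->
  (forall x y, `|F (x, y)| <= A * (1 + x ^+ 2) * (1 + y ^+ 2)) ->
  exp_mean a (fun x => exp_mean b (fun y => F (x, y))) =
  exp_mean b (fun y => exp_mean a (fun x => F (x, y))).
Proof.
move=> a0 b0 mF FA.
have q1 x : quad_growth (fun y => F (x, y)).
  split; first exact: (measurableT_comp mF (pair1_measurable x)).
  by exists (A * (1 + x ^+ 2)) => y.
have q2 y : quad_growth (fun x => F (x, y)).
  split; first exact: (measurableT_comp mF (pair2_measurable y)).
  by exists (A * (1 + y ^+ 2)) => x; rewrite mulrAC.
rewrite (exp_mean_iterE a b0 q1) (@exp_mean_iterE b a (fun z => F (z.2, z.1)) a0 q2).
apply: (congr1 fine).
pose G (z : R * R) := exponential_pdf a z.1 * exponential_pdf b z.2 * F z.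
have iG : (mu \x mu)%E.-integrable setT (EFin \o G).
  apply: (@integrable_prod_bound _ _ _ _ _ mu mu G
    (fun x => exponential_pdf a x * (A * (1 + x ^+ 2)))
    (fun y => exponential_pdf b y * (1 * (1 + y ^+ 2)))).
  - apply: measurable_funM => //; apply: measurable_funM; apply: measurableT_comp => //;
    exact: measurable_exponential_pdf.
  - exact: (integrable_exponential_quad a0 (quad_growth_sqr _)).
  - exact: (integrable_exponential_quad b0 (quad_growth_sqr _)).
  - move=> x y; rewrite /G/= !normrM.
    rewrite !(ger0_norm (exponential_pdf_ge0 (ltW _) _))//.
    have -> : exponential_pdf a x * (A * (1 + x ^+ 2)) *
      (exponential_pdf b y * (1 * (1 + y ^+ 2))) =
      exponential_pdf a x * exponential_pdf b y * (A * (1 + x ^+ 2) * (1 + y ^+ 2)).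
      by ring.
    by rewrite ler_wpM2l// mulr_ge0// exponential_pdf_ge0// ltW.
transitivity (\int[mu]_y \int[mu]_x (EFin \o G) (x, y))%E.
  exact: (Fubini iG).
by apply: eq_integral => y _; apply: eq_integral => x _; rewrite /G/= [exponential_pdf a _ * _]mulrC.
Qed.

(** e^{-b x} times the density of rate [a] is proportional to the density of
    rate [a + b]. *)
Lemma exp_mean_laplace a b : 0 < a -> 0 < b ->
  exp_mean a (fun x => expR (- b * x)) = a / (a + b).
Proof.
move=> a0 b0; have ab0 : 0 < a + b by exact: addr_gt0.
transitivity (exp_mean (a + b) (cst (a / (a + b)))); last exact: exp_mean_cst.
apply: eq_Rintegral => x _; have [x0|x0] := ltP x 0.
  by rewrite !lt0_exponential_pdf// !mul0r.
rewrite !exponential_pdfE// -mulrA -expRD [RHS]mulrAC mulrA.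
by congr (_ * expR _); [field; rewrite gt_eqF|ring].
Qed.

Lemma exp_mean_delay_mean a b g : 0 < a -> 0 < b -> quad_growth g ->
  (forall x, x < 0 -> g x = 0) ->
  exp_mean a (fun x => exp_mean b (fun y => g (y - x))) = a / (a + b) * exp_mean b g.
Proof.
move=> a0 b0 qg g0.
transitivity (exp_mean a (fun x => exp_mean b g * expR (- b * `|x|))).
  by apply: exp_mean_eq => x x0; rewrite exp_mean_delay// mulrC ger0_norm.
rewrite exp_meanZ//.
  rewrite mulrC -(exp_mean_laplace a0 b0); congr (_ * _).
  by apply: exp_mean_eq => x x0; rewrite ger0_norm.
split.
  by apply: measurableT_comp => //; apply: measurable_funM.
exists 1 => x; rewrite ger0_norm ?expR_ge0// mul1r.
apply: (@le_trans _ _ 1); last by rewrite lerDl sqr_ge0.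
by rewrite -expR0 ler_expR mulNr oppr_le0 mulr_ge0// ltW.
Qed.

Lemma quad_growth_exp_mean_shift b g : 0 < b -> quad_growth g ->
  quad_growth (fun u => exp_mean b (fun y => g (u + y))).
Proof.
move=> b0 qg; rewrite (_ : (fun u => _) = (fun u => g u - half_cov g b u)).
  exact: quad_growthB qg (quad_growth_half_cov b0 qg).
by apply/funext => u; rewrite half_covE// opprB addrC subrK.
Qed.

Lemma quad_growth_exp_mean_delay b g : 0 < b -> quad_growth g ->
  quad_growth (fun x => exp_mean b (fun y => g (y - x))).
Proof.
move=> b0 qg; have := quad_growth_opp (quad_growth_exp_mean_shift b0 qg).
by under eq_fun do under eq_fun do rewrite addrC.
Qed.

(** The only genuinely double mean is that of k(y - x), for x and y independent
    exponential times.  Splitting it according to the sign of y - x, the overshoot of the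
    larger time over the smaller one is again exponential by memorylessness,
    and each order has probability a / (a + b) or b / (a + b). *)
Lemma stat_cov0 k a b : 0 < a -> 0 < b -> quad_growth k -> k 0 = 0 ->
  stat_cov k a b 0 = - (a / (a + b) * exp_mean a (fun x => k (- x)))
                     - b / (a + b) * exp_mean b k.
Proof.
move=> a0 b0 qk k0; have ab0 : a + b != 0 by rewrite gt_eqF ?addr_gt0.
rewrite stat_covE// half_covE// k0 sub0r.
have -> : exp_mean b (fun y => k (0 + y)) = exp_mean b k.
  by apply: exp_mean_eq => y _; rewrite add0r.
pose kp x := if 0 <= x then k x else 0.
pose km x := if 0 <= x then 0 else k x.
have [mk [A kA]] := qk; have A0 := quad_growth_bound_ge0 (kA 0).
have m0 : measurable_fun setT (fun x : R => (0 : R) <= x).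
  by apply: measurable_fun_ler.
have qp : quad_growth kp.
  split; first exact: measurable_fun_ifT.
  exists A => x; rewrite /kp; case: ifP => _ //.
  by rewrite normr0 mulr_ge0// addr_ge0// sqr_ge0.
have qm : quad_growth km.
  split; first exact: measurable_fun_ifT.
  exists A => x; rewrite /km; case: ifP => _ //.
  by rewrite normr0 mulr_ge0// addr_ge0// sqr_ge0.
have kpm x : k x = kp x + km x by rewrite /kp /km; case: ifP; rewrite ?addr0 ?add0r.
have -> : exp_mean a (fun x => half_cov k b (0 - x)) =
  exp_mean a (fun x => k (- x)) -
  exp_mean a (fun x => exp_mean b (fun y => kp (y - x)) + exp_mean b (fun y => km (y - x))).
  rewrite -exp_meanB//; last 2 first.
  - exact: quad_growth_opp.
  - by apply: quad_growthD; exact: quad_growth_exp_mean_delay.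
  apply: exp_mean_eq => x _; rewrite half_covE// sub0r; congr (_ - _).
  rewrite -exp_meanD//; last 2 first.
  - by have := quad_growth_shift (- x) qp; under eq_fun do rewrite addrC.
  - by have := quad_growth_shift (- x) qm; under eq_fun do rewrite addrC.
  by apply: exp_mean_eq => y _; rewrite kpm [- x + y]addrC.
rewrite exp_meanD//; last 2 first.
- exact: quad_growth_exp_mean_delay.
- exact: quad_growth_exp_mean_delay.
rewrite exp_mean_delay_mean//; last by move=> x x0; rewrite /kp leNgt x0.
rewrite (exp_mean_swap (F := fun z => km (z.2 - z.1)) (A := 2 * A) a0 b0)/=; last 2 first.
- apply: measurableT_comp; first by case: qm.
  exact: measurable_funB.
- move=> x y; apply: (@le_trans _ _ (A * (1 + (y - x) ^+ 2))).
    rewrite /km; case: ifP => _ //.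
    by rewrite normr0 mulr_ge0// addr_ge0// sqr_ge0.
  rewrite -!mulrA [leRHS]mulrCA ler_wpM2l//.
  have := sqr_ge0 (y + x); have := mulr_ge0 (sqr_ge0 x) (sqr_ge0 y).
  have := sqr_ge0 x; rewrite !expr2; nra.
have -> : exp_mean b (fun y => exp_mean a (fun x => km (y - x))) =
    b / (b + a) * exp_mean a (fun x => km (- x)).
  have km0 x : x < 0 -> km (- x) = 0 by move=> x0; rewrite /km oppr_ge0 ltW.
  rewrite -(exp_mean_delay_mean b0 a0 (quad_growth_opp qm) km0).
  by apply: exp_mean_eq => y _; apply: exp_mean_eq => x _; rewrite opprB.
have -> : exp_mean b kp = exp_mean b k.
  by apply: exp_mean_eq => x x0; rewrite /kp x0.
have -> : exp_mean a (fun x => km (- x)) = exp_mean a (fun x => k (- x)).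
  apply: exp_mean_eq => x x0; rewrite /km oppr_ge0.
  by case: ifPn => // x0'; have -> : x = 0 by [apply/eqP; rewrite eq_le x0 x0']; rewrite oppr0.
by field; rewrite !gt_eqF ?addr_gt0.
Qed.
End cov_at_zero.

(** * The increment kernel of multivariate fractional Brownian motion *)

Section mfBm_kernel.
Context {R : realType}.
Notation mu := (@lebesgue_measure R).
Implicit Types (h rho eta a b r t s x y : R).

(** The part of [mfBm_cov] at times t, s which depends on both times, as a
    function of r = t - s. *)
Definition lag_kernel h rho eta r : R :=
  if h == 1 then - (rho * `|r| - eta * (r * ln `|r|)) / 2
  else - ((rho - sign (- r) * eta) * `|r| `^ h) / 2.

(** [mfBm_cov] is the sum of a function of t, a function of s and [lag_kernel],
    and the first two disappear in a second difference. *)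
Lemma mfBm_cov_increments h rho eta t s x y :
  mfBm_cov h rho eta t s - mfBm_cov h rho eta (t - x) s
  - mfBm_cov h rho eta t (s - y) + mfBm_cov h rho eta (t - x) (s - y) =
  lag_kernel h rho eta (t - s) - lag_kernel h rho eta (t - s - x)
  - lag_kernel h rho eta (t - s + y) + lag_kernel h rho eta (t - s - x + y).
Proof.
have [f [g E]] : exists f g : R -> R, forall u v,
    mfBm_cov h rho eta u v = f u + g v + lag_kernel h rho eta (u - v).
  exists (fun u => mfBm_cov h rho eta u 0 - lag_kernel h rho eta u).
  exists (fun v => mfBm_cov h rho eta 0 v - lag_kernel h rho eta (- v)
    - (mfBm_cov h rho eta 0 0 - lag_kernel h rho eta 0)) => u v.
  rewrite /mfBm_cov /lag_kernel; case: ifPn => h1.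
    rewrite !sub0r !subr0 !oppr0 !normr0 !mul0r !normrN -[v - u]opprB normrN.
    by ring.
  rewrite !opprK !sub0r !subr0 !oppr0 !normr0 !normrN !opprB -[v - u]opprB normrN.
  by ring.
rewrite !E; move: (lag_kernel h rho eta) => k.
have -> : t - x - s = t - s - x by ring.
have -> : t - (s - y) = t - s + y by ring.
have -> : t - x - (s - y) = t - s - x + y by ring.
by ring.
Qed.

Lemma powR_le_sqr h x : 0 < h < 2 -> `|x| `^ h <= 1 + x ^+ 2.
Proof.
move=> /andP[h0 h2]; have [x1|x1] := leP `|x| 1.
  apply: (@le_trans _ _ (1 `^ h)); last by rewrite powR1 lerDl sqr_ge0.
  by apply: ge0_ler_powR => //; rewrite ?nnegrE// ltW.
apply: (@le_trans _ _ (`|x| `^ 2)); first by rewrite ler_powR// ltW.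
by rewrite powR_mulrn// -normrX ger0_norm ?sqr_ge0// lerDr.
Qed.

Lemma quad_growth_powR h : 0 < h < 2 -> quad_growth (fun x : R => `|x| `^ h).
Proof.
move=> h02; split.
  exact: (measurableT_comp (measurable_powR h) (@normr_measurable R setT)).
by exists 1 => x; rewrite mul1r ger0_norm ?powR_ge0// powR_le_sqr.
Qed.

Lemma oppr_ln_lt x : 0 < x -> - ln x < x^-1.
Proof. by move=> x0; rewrite -lnV ?posrE// ln_sublinear// invr_gt0. Qed.

Lemma quad_growth_xlnx : quad_growth (fun x : R => x * ln `|x|).
Proof.
split.
  apply: measurable_funM => //.
  exact: (measurableT_comp (@measurable_ln R) (@normr_measurable R setT)).
exists 1 => x; rewrite mul1r normrM.
have [->|x0] := eqVneq x 0; first by rewrite normr0 mul0r addr_ge0 ?sqr_ge0.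
have ax0 : 0 < `|x| by rewrite normr_gt0.
rewrite -[x ^+ 2]ger0_norm ?sqr_ge0// normrX.
move: `|x| ax0 => z ax0; have [z1|z1] := leP 1 z.
  rewrite ger0_norm ?ln_ge0//.
  by rewrite ler_wpDl// expr2 ler_wpM2l ?ltW// ln_sublinear.
rewrite ler0_norm ?ln_le0 ?(ltW z1)// ler_wpDr ?sqr_ge0//.
by rewrite -(mulfV (lt0r_neq0 ax0)) ler_pM2l// ltW// oppr_ln_lt.
Qed.

(** With y the square root of x, |x ln x| = -2 y^2 ln y is at most 2 y. *)
Lemma xlnx_cvg0 : x * ln `|x| @[x --> (0 : R)^'+] --> (0 : R).
Proof.
apply: norm_cvg0.
apply: (@squeeze_cvgr _ _ _ _ (cst 0) (fun x : R => 2 * x `^ 2^-1)); last 2 first.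
- exact: cvg_cst.
- by rewrite -[X in _ --> X](mulr0 2); apply: cvgM; [exact: cvg_cst|apply: powR_cvg0; rewrite invr_gt0].
near=> x; rewrite normr_ge0/=.
have x0 : 0 < x by near: x; exact: nbhs_right_gt.
have x1 : x < 1 by near: x; exact: nbhs_right_lt.
rewrite normrM (gtr0_norm x0) ler0_norm ?ln_le0 ?(ltW x1)//.
set y := x `^ 2^-1; have y0 : 0 < y by exact: powR_gt0.
have yy : x = y * y.
  rewrite /y -powRD ?(gt_eqF x0) ?implybT//.
  by have -> : 2^-1 + 2^-1 = 1 :> R; [field|rewrite powRr1// ltW].
rewrite yy lnM ?posrE//.
have := oppr_ln_lt y0; rewrite -(ltr_pM2l y0) mulfV ?gt_eqF// => h.
nra.
Unshelve. all: by end_near. Qed.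

Lemma lag_kernel0 h rho eta : h != 0 -> lag_kernel h rho eta 0 = 0.
Proof.
move=> h0; rewrite /lag_kernel normr0 powR0// mul0r !mulr0.
by case: ifP; rewrite ?subr0 oppr0 mul0r.
Qed.

Lemma quad_growth_lag_kernel h rho eta : 0 < h < 2 ->
  quad_growth (lag_kernel h rho eta).
Proof.
move=> h02; rewrite /lag_kernel; have [h1|h1] := eqVneq h 1.
  have -> : (fun r => - (rho * `|r| - eta * (r * ln `|r|)) / 2) =
    (fun r => (- rho / 2) * `|r| `^ 1 + (eta / 2) * (r * ln `|r|)).
    by apply/funext => r; rewrite powRr1//; field.
  apply: quad_growthD; apply: quad_growthZ; last exact: quad_growth_xlnx.
  by apply: quad_growth_powR; rewrite ltr01 ltr1n.
have [mp [A pA]] := quad_growth_powR h02.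
split.
  apply: measurable_funM => //; apply: measurableT_comp => //.
  apply: measurable_funM => //; apply: measurable_funB => //.
  apply: measurable_funM => //; rewrite /sign.
  by apply: measurable_fun_ifT => //; apply: measurable_fun_ler.
exists ((`|rho| + `|eta|) * A) => x.
rewrite normrM normrN normrM -mulrA.
have -> : `|2^-1 : R| = 2^-1 by rewrite ger0_norm.
apply: (@le_trans _ _ ((`|rho| + `|eta|) * (A * (1 + x ^+ 2)))); last by rewrite mulrA.
apply: ler_pM => //.
  apply: le_trans (ler_normB _ _) _; rewrite lerD2l normrM.
  rewrite /sign; case: ifP => _; first by rewrite normr1 mul1r.
  by rewrite normrN normr1 mul1r.
apply: le_trans (pA x); rewrite ger0_norm ?powR_ge0//.
by rewrite ler_piMr ?powR_ge0// invf_le1// ler1n.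
Qed.

Lemma lag_kernel_right_continuous h rho eta : 0 < h ->
  lag_kernel h rho eta r @[r --> 0^'+] --> lag_kernel h rho eta 0.
Proof.
move=> h0; rewrite lag_kernel0 ?gt_eqF//; rewrite /lag_kernel.
have [h1|h1] := eqVneq h 1.
  rewrite -[X in _ --> X](mul0r 2^-1); apply: cvgM; last exact: cvg_cst.
  rewrite -[X in _ --> X]oppr0; apply: cvgN; rewrite -[X in _ --> X](subr0 0); apply: cvgB.
    rewrite -[X in _ --> X](mulr0 rho); apply: cvgM; first exact: cvg_cst.
    rewrite -[X in _ --> X](@normr0 _ R); apply: cvg_norm.
    by apply: cvg_at_right_filter; exact: cvg_id.
  rewrite -[X in _ --> X](mulr0 eta); apply: cvgM; first exact: cvg_cst.
  exact: xlnx_cvg0.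
have : - ((rho + eta) * r `^ h) / 2 @[r --> 0^'+] --> (0 : R).
  rewrite -[X in _ --> X](mul0r 2^-1); apply: cvgM; last exact: cvg_cst.
  rewrite -[X in _ --> X]oppr0; apply: cvgN; rewrite -[X in _ --> X](mulr0 (rho + eta)).
  by apply: cvgM; [exact: cvg_cst|exact: powR_cvg0].
apply: cvg_trans; apply: near_eq_cvg; near=> r.
have r0 : 0 < r by near: r; exact: nbhs_right_gt.
by rewrite gtr0_norm// /sign oppr_ge0 leNgt r0/= mulN1r opprK.
Unshelve. all: by end_near. Qed.

(** The derivative of [lag_kernel] on the positive half-line. *)
Definition lag_kernel1 h rho eta r : R :=
  if h == 1 then - rho / 2 + eta / 2 * (ln r + 1)
  else - (rho + eta) / 2 * (h * r `^ (h - 1)).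

(** The constant c such that the second derivative of [lag_kernel] at x > 0 is
    -c x^{h - 2}. *)
Definition lag_curvature h rho eta : R :=
  if h == 1 then - eta / 2 else (rho + eta) / 2 * (h * (h - 1)).

Lemma is_derive_lag_kernel h rho eta (x : R) : 0 < x ->
  is_derive x 1 (lag_kernel h rho eta) (lag_kernel1 h rho eta x).
Proof.
move=> x0; rewrite /lag_kernel1; case: ifPn => h1.
  apply: (near_eq_is_derive (f := fun r => - rho / 2 * r + eta / 2 * (r * ln r))).
    near=> r; rewrite /lag_kernel h1.
    have r0 : 0 < r by near: r; exact: lt_nbhsr.
    by rewrite gtr0_norm//; field.
  have dl := is_derive1_ln x0.
  apply: is_derive_eq; rewrite /GRing.scale/=.
  by field; rewrite gt_eqF.
apply: (near_eq_is_derive (f := fun r => - (rho + eta) / 2 * r `^ h)).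
  near=> r; rewrite /lag_kernel (negbTE h1).
  have r0 : 0 < r by near: r; exact: lt_nbhsr.
  by rewrite gtr0_norm// /sign oppr_ge0 leNgt r0/=; field.
have dp := is_derive1_powR h x0.
by apply: is_derive_eq; rewrite /GRing.scale/=; ring.
Unshelve. all: by end_near. Qed.

Lemma is_derive_lag_kernel1 h rho eta (x : R) : 0 < x ->
  is_derive x 1 (lag_kernel1 h rho eta) (- lag_curvature h rho eta * x `^ (h - 2)).
Proof.
move=> x0; rewrite /lag_kernel1 /lag_curvature; case: ifPn => [/eqP ->|h1].
  have -> : 1 - 2 = -1 :> R by ring.
  rewrite (powR_inv1 (ltW x0)); have dl := is_derive1_ln x0.
  by apply: is_derive_eq; rewrite /GRing.scale/=; field; rewrite gt_eqF.
have dp := is_derive1_powR (h - 1) x0.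
apply: is_derive_eq; rewrite /GRing.scale/=.
have -> : h - 1 - 1 = h - 2 by ring.
by field.
Qed.

Lemma lag_kernel1_growth h rho eta : 0 < h < 2 ->
  exists A, forall x, 1 <= x -> `|lag_kernel1 h rho eta x| <= A * (1 + x ^+ 2).
Proof.
move=> /andP[h0 h2]; rewrite /lag_kernel1; have [h1|h1] := eqVneq h 1.
  exists (`|rho| + `|eta|) => x x1.
  have x0 : 0 < x by exact: lt_le_trans x1.
  have l0 := ln_ge0 x1; have lx := ln_sublinear x0.
  apply: le_trans (ler_normD _ _) _.
  have l1 : 0 <= ln x + 1 by rewrite addr_ge0.
  rewrite !normrM normrN (ger0_norm l1).
  have -> : `|2^-1 : R| = 2^-1 by rewrite ger0_norm.
  have r0 := normr_ge0 rho; have e0 := normr_ge0 eta.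
  have hx : ln x + 1 <= 1 + x ^+ 2 by rewrite expr2; nra.
  have h1x : 1 <= 1 + x ^+ 2 by rewrite lerDl sqr_ge0.
  have := ler_wpM2l e0 hx; have := ler_wpM2l r0 h1x; rewrite !expr2; nra.
exists (`|(rho + eta) / 2| * `|h|) => x x1.
rewrite !mulNr normrN !normrM !mulrA ler_wpM2l ?mulr_ge0//.
rewrite ger0_norm ?powR_ge0//.
apply: (@le_trans _ _ (x `^ 2)).
  by rewrite ler_powR// lerBlDr (le_trans (ltW h2))// lerDl.
by rewrite powR_mulrn ?(le_trans _ x1)// lerDr.
Qed.
End mfBm_kernel.

(** * Gamma and logarithmic integrals *)

Section exponential_integrals.
Context {R : realType}.
Notation mu := (@lebesgue_measure R).
Implicit Types (h rho eta a b c x : R).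

Lemma quad_growth_scale c (f : R -> R) : quad_growth f -> quad_growth (fun x => f (c * x)).
Proof.
move=> [mf [A fA]]; split.
  by apply: measurableT_comp => //; exact: measurable_funM.
exists (A * (1 + c ^+ 2)) => x; apply: le_trans (fA _) _.
rewrite -mulrA ler_wpM2l ?(quad_growth_bound_ge0 (fA 0))//.
have := sqr_ge0 c; have := sqr_ge0 x; rewrite !expr2; nra.
Qed.

Lemma exp_mean_scale b (f : R -> R) : 0 < b -> quad_growth f ->
  exp_mean b f = exp_mean 1 (fun x => f (b^-1 * x)).
Proof.
move=> b0 qf; rewrite {2}/exp_mean (@Rintegral_affine _ _ b 0)//; last first.
  exact: (integrable_exponential_quad ltr01 (quad_growth_scale _ qf)).
have qg : quad_growth (fun x => b^-1 * f x) by exact: quad_growthZ.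
transitivity (b * exp_mean b (fun x => b^-1 * f x)).
  by rewrite exp_meanZ// mulrA mulfV ?gt_eqF// mul1r.
congr (_ * _); apply: eq_Rintegral => x _.
rewrite addr0 mulKf ?gt_eqF//; have [x0|x0] := ltP x 0.
  by rewrite !lt0_exponential_pdf ?mul0r// pmulr_rlt0.
rewrite !exponential_pdfE ?mul1r ?mulN1r ?mulNr//; last by rewrite mulr_ge0// ltW.
by field; rewrite gt_eqF.
Qed.

Lemma Gamma_exp_mean h : 0 < h < 2 ->
  Gamma (h + 1) = exp_mean 1 (fun x => `|x| `^ h).
Proof.
move=> h02; rewrite /Gamma.
have qh := quad_growth_powR h02.
have i := integrable_exponential_quad (@ltr01 R) qh.
rewrite /exp_mean.
transitivity (\int[mu]_(x in `]0, +oo[) (exponential_pdf 1 x * `|x| `^ h)).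
  apply: eq_Rintegral => x; rewrite inE/= in_itv/= andbT => x0.
  rewrite exponential_pdfE ?(ltW x0)// mul1r mulN1r gtr0_norm// addrK.
  by rewrite mulrC.
rewrite Rintegral_mkcond; apply: eq_Rintegral => x _; rewrite patchE.
case: ifPn => //; rewrite notin_setE/= in_itv/= andbT => /negP; rewrite -leNgt.
rewrite le_eqVlt => /predU1P[->|x0]; last by rewrite lt0_exponential_pdf// mul0r.
by rewrite normr0 powR0 ?mulr0//; case/andP : h02 => /lt0r_neq0.
Qed.

Lemma exp_mean_powR b h : 0 < b -> 0 < h < 2 ->
  exp_mean b (fun x => `|x| `^ h) = b `^ (- h) * Gamma (h + 1).
Proof.
move=> b0 h02; rewrite exp_mean_scale//; last exact: quad_growth_powR.
rewrite Gamma_exp_mean// -exp_meanZ//; last exact: quad_growth_powR.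
apply: exp_mean_eq => x x0; rewrite normrM powRM//; congr (_ * _).
by rewrite gtr0_norm ?invr_gt0// -(powR_inv1 (ltW b0)) -powRrM mulN1r.
Qed.

Lemma quad_growth_id : quad_growth (fun x : R => x).
Proof.
split => //; exists 1 => x; rewrite mul1r.
have := sqr_ge0 (x - 1); have := sqr_ge0 (x + 1).
rewrite ler_norml !expr2 => *; apply/andP; split; nra.
Qed.

Lemma exp_mean_id1 : exp_mean 1 (fun x : R => x) = 1.
Proof.
rewrite /exp_mean.
have -> : \int[mu]_x (exponential_pdf 1 x * x) =
    \int[mu]_(x in `[0, +oo[) (expR (- 1 * x) * x).
  rewrite [RHS]Rintegral_mkcond; apply: eq_Rintegral => x _; rewrite patchE.
  case: ifPn; first by rewrite inE/= in_itv/= andbT => x0; rewrite exponential_pdfE// mul1r.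
  rewrite notin_setE/= in_itv/= andbT => /negP; rewrite -ltNge => x0.
  by rewrite lt0_exponential_pdf// mul0r.
pose f x : R := expR (- 1 * x) * Num.max 0 x.
pose F x : R := expR (- 1 * x) * (- 1 - x).
have dF x : is_derive x 1 F (expR (- 1 * x) * x).
  have he := is_derive_expRM (- 1) x.
  by apply: is_derive_eq; rewrite /GRing.scale/=; ring.
transitivity (\int[mu]_(x in `[0, +oo[) f x).
  by apply: eq_Rintegral => x; rewrite inE/= in_itv/= andbT => x0; rewrite /f max_r.
have cF : F @ +oo --> (0 : R).
  apply: (@expR_quad_decay _ 1 (fun x => - 1 - x) 2) => //.
  move=> x x1; rewrite ler0_norm; last lra.
  by rewrite expr2; nra.
have cf : {within `[0, +oo[, continuous f}.
  apply: continuous_subspaceT => x.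
  apply: (@continuousM _ _ (fun x => expR (- 1 * x)) (fun x => Num.max 0 x)).
    exact: is_derive_continuous (is_derive_expRM _ _).
  exact: (continuous_max (cvg_cst _) cvg_id).
have := @Rintegral_ge0_continuous_FTC2y _ f F 0 0 _ cf cF.
have -> : 0 - F 0 = 1 by rewrite /F mulr0 expR0; ring.
apply.
- by move=> x x0; rewrite /f mulr_ge0 ?expR_ge0 ?le_max ?lexx.
- by move=> x _; case: (dF x).
- apply: cvg_at_right_filter; exact: is_derive_continuous (dF 0).
- move=> x; rewrite in_itv/= andbT => x0; rewrite derive1E.
  by rewrite /f max_r ?(ltW x0)//; case: (dF x).
Qed.

Lemma exp_mean_id b : 0 < b -> exp_mean b (fun x : R => x) = b^-1.
Proof.
move=> b0; rewrite exp_mean_scale//; last exact: quad_growth_id.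
by rewrite exp_meanZ//; [rewrite exp_mean_id1 mulr1|exact: quad_growth_id].
Qed.

(** The constant on the right is not evaluated: it cancels in
    [stat_cov_lag0_eq1]. *)
Lemma exp_mean_xlnx b : 0 < b ->
  exp_mean b (fun x : R => x * ln `|x|) =
  b^-1 * (exp_mean 1 (fun x : R => x * ln `|x|) - ln b).
Proof.
move=> b0; rewrite exp_mean_scale//; last exact: quad_growth_xlnx.
have E : ln b = exp_mean 1 (fun x => ln b * x).
  by rewrite exp_meanZ ?exp_mean_id1 ?mulr1//; exact: quad_growth_id.
rewrite {1}E.
have q1 := quad_growthZ (ln b) quad_growth_id.
rewrite -exp_meanB//; last exact: quad_growth_xlnx.
rewrite -exp_meanZ//; last exact: quad_growthB quad_growth_xlnx q1.
apply: exp_mean_eq => x; rewrite le_eqVlt => /predU1P[<-|x0].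
  by rewrite !(mulr0, mul0r, subr0).
have b0' : 0 < b^-1 by rewrite invr_gt0.
rewrite !gtr0_norm ?mulr_gt0// lnM ?posrE// lnV ?posrE//.
by ring.
Qed.

Lemma stat_cov_lag0_neq1 h rho eta a b : 0 < h < 2 -> h != 1 -> 0 < a -> 0 < b ->
  stat_cov (lag_kernel h rho eta) a b 0 =
  Gamma (h + 1) / (2 * (a + b)) *
    ((a `^ (1 - h) + b `^ (1 - h)) * rho + (b `^ (1 - h) - a `^ (1 - h)) * eta).
Proof.
move=> h02 h1 a0 b0; have h0 : h != 0 by case/andP : h02 => /lt0r_neq0.
rewrite stat_cov0 ?lag_kernel0//; last exact: quad_growth_lag_kernel.
have qp := quad_growth_powR h02.
have -> : exp_mean a (fun x => lag_kernel h rho eta (- x)) =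
    exp_mean a (fun x => (- (rho - eta) / 2) * `|x| `^ h).
  apply: exp_mean_eq => x x0.
  by rewrite /lag_kernel (negbTE h1) normrN opprK /sign x0; field.
have -> : exp_mean b (lag_kernel h rho eta) =
    exp_mean b (fun x => (- (rho + eta) / 2) * `|x| `^ h).
  apply: exp_mean_eq => x; rewrite le_eqVlt => /predU1P[<-|x0].
    by rewrite lag_kernel0// normr0 powR0// mulr0.
  by rewrite /lag_kernel (negbTE h1) /sign oppr_ge0 leNgt x0/=; field.
rewrite !exp_meanZ// !exp_mean_powR//.
have e c : 0 < c -> c `^ (1 - h) = c * c `^ (- h).
  move=> c0; rewrite powRD; last by apply/implyP => _; exact: lt0r_neq0.
  by rewrite powRr1// ltW.
rewrite !e//; field; rewrite gt_eqF ?addr_gt0//.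
Qed.

Lemma stat_cov_lag0_eq1 rho eta a b : 0 < a -> 0 < b ->
  stat_cov (lag_kernel 1 rho eta) a b 0 =
  (a + b)^-1 * (rho + eta / 2 * (ln b - ln a)).
Proof.
move=> a0 b0; have h02 : 0 < (1 : R) < 2 by rewrite ltr01 ltr1n.
rewrite stat_cov0 ?lag_kernel0 ?oner_neq0//; last exact: quad_growth_lag_kernel.
have q1 := quad_growth_id; have q2 := quad_growth_xlnx (R := R).
have -> : exp_mean a (fun x => lag_kernel 1 rho eta (- x)) =
    exp_mean a (fun x => (- rho / 2) * x + (- eta / 2) * (x * ln `|x|)).
  apply: exp_mean_eq => x x0.
  by rewrite /lag_kernel eqxx normrN (ger0_norm x0); field.
have -> : exp_mean b (lag_kernel 1 rho eta) =
    exp_mean b (fun x => (- rho / 2) * x + (eta / 2) * (x * ln `|x|)).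
  apply: exp_mean_eq => x x0.
  by rewrite /lag_kernel eqxx (ger0_norm x0); field.
rewrite !exp_meanD//; try exact: quad_growthZ.
rewrite !exp_meanZ// !exp_mean_id// (exp_mean_xlnx a0) (exp_mean_xlnx b0).
by field; rewrite !gt_eqF// addr_gt0.
Qed.

Lemma stat_cov_lag h rho eta a b t : 0 < h < 2 -> 0 < a -> 0 < b -> 0 < t ->
  stat_cov (lag_kernel h rho eta) a b t =
  expR (- a * t) * stat_cov (lag_kernel h rho eta) a b 0 +
  expR (- a * t) * (lag_curvature h rho eta * mfOU_I h a b t).
Proof.
move=> h02 a0 b0 t0; have [h0 _] := andP h02.
exact (stat_cov_integral a0 b0 (@quad_growth_lag_kernel R h rho eta h02)
  (@lag_kernel_right_continuous R h rho eta h0)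
  (@is_derive_lag_kernel R h rho eta) (@is_derive_lag_kernel1 R h rho eta)
  (@lag_kernel1_growth R h rho eta h02) t0).
Qed.
End exponential_integrals.

(** * Limits of finite-dimensional laws *)

Section finite_dimensional_laws.
Context (dT : measure_display) (T : measurableType dT) (R : realType).
Variable P : probability T R.

Lemma bounded_cvg_expectation (f_ : nat -> T -> R) (f : T -> R) :
  (forall n, measurable_fun setT (f_ n)) -> measurable_fun setT f ->
  (forall n w, `|f_ n w| <= 1) ->
  {ae P, forall w, f_ n w @[n --> \oo] --> f w} ->
  (\int[P]_w (f_ n w)%:E @[n --> \oo] --> \int[P]_w (f w)%:E)%E.
Proof.
move=> mf_ mf f1 cf.
have [||||//|_ _] := @dominated_convergence _ T R P setT measurableT
  (fun n w => (f_ n w)%:E) (fun w => (f w)%:E) (cst 1%:E).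
- by move=> n; exact/measurable_EFinP.
- exact/measurable_EFinP.
- by move: cf; apply: filterS => w cw _; apply: cvg_EFin; [exact: nearW|exact: cw].
- apply/integrableP; split => //.
  by rewrite integral_cst//= probability_setT mule1 ltry.
- by apply: aeW => w n _; rewrite lee_fin.
- exact.
Qed.

(** Continuous functions bounded by 1 which tend to the indicator of ]0, oo[. *)
Let ramp (m : nat) (u : R) : R := Num.min 1 (m%:R * Num.max 0 u).

Let ramp_ge0 m u : 0 <= ramp m u.
Proof. by rewrite le_min ler01 mulr_ge0 ?ler0n// le_max lexx. Qed.

Let ramp_norm m u : `|ramp m u| <= 1.
Proof. by rewrite ger0_norm ?ramp_ge0// ge_min lexx. Qed.

Let continuous_ramp m : continuous (ramp m).
Proof.
move=> u.
have h1 : {for u, continuous (fun u : R => Num.max 0 u)}.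
  by apply: (@continuous_max R R (fun=> (0 : R)) id u); [exact: cvg_cst|exact: cvg_id].
have h2 : {for u, continuous (fun u : R => m%:R * Num.max 0 u)}.
  by apply: (@continuousM R R (fun=> m%:R) (fun u : R => Num.max 0 u)); [exact: cvg_cst|].
by apply: (@continuous_min R R (fun=> (1 : R)) (fun u : R => m%:R * Num.max 0 u) u); [exact: cvg_cst|].
Qed.

Let measurable_ramp m : measurable_fun setT (ramp m).
Proof. exact: continuous_measurable_fun. Qed.

Let ramp_cvg (u : R) : ramp m u @[m --> \oo] --> ((0 < u)%R%:R : R).
Proof.
have [u0|u0] := ltP 0 u; last first.
  apply: cvg_near_cst; near=> m.
  by rewrite /ramp max_l// mulr0 min_r// ler01.
apply: cvg_near_cst; near=> m.
rewrite /ramp max_r ?ltW// min_l// -ler_pdivrMr// mul1r.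
near: m; exact: nbhs_infty_ger.
Unshelve. all: by end_near. Qed.

(** Expectations of [ramp m] pass to almost sure limits by dominated
    convergence, and then m is sent to infinity; the ramps increase to the indicator of the
    open half-line, so atoms of the limits at 0 do no harm. *)
Lemma law_limit_gt0 (U V : nat -> T -> R) (u v : T -> R) :
  (forall n, measurable_fun setT (U n)) -> (forall n, measurable_fun setT (V n)) ->
  measurable_fun setT u -> measurable_fun setT v ->
  {ae P, forall w, U n w @[n --> \oo] --> u w} ->
  {ae P, forall w, V n w @[n --> \oo] --> v w} ->
  (forall n (B : set R), measurable B -> P (U n @^-1` B) = P (V n @^-1` B)) ->
  P [set w | 0 < u w] = P [set w | 0 < v w].
Proof.
move=> mU mV mu mv cU cV UV.
have mc (f : T -> R) m : measurable_fun setT f -> measurable_fun setT (fun w => ramp m (f w)).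
  by move=> mf; exact: measurableT_comp.
have E1 m n : (\int[P]_w (ramp m (U n w))%:E = \int[P]_w (ramp m (V n w))%:E)%E.
  have pf (f : T -> R) : measurable_fun setT f ->
      (\int[P]_w (ramp m (f w))%:E = \int[pushforward P f]_y (ramp m y)%:E)%E.
    move=> mf; rewrite ge0_integral_pushforward//; first exact/measurable_EFinP.
    by move=> y _; rewrite lee_fin ramp_ge0.
  rewrite (pf _ (mU n)) (pf _ (mV n)).
  by apply: eq_measure_integral => B mB _; exact: UV.
have lim_ramp (W : nat -> T -> R) (x : T -> R) m :
    (forall n, measurable_fun setT (W n)) -> measurable_fun setT x ->
    {ae P, forall w, W n w @[n --> \oo] --> x w} ->
    (\int[P]_w (ramp m (W n w))%:E @[n --> \oo] --> \int[P]_w (ramp m (x w))%:E)%E.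
  move=> mW mx cW; apply: bounded_cvg_expectation => //.
  - by move=> n; exact: mc.
  - exact: mc.
  - move: cW; apply: filterS => w cw.
    by apply: continuous_cvg => //; exact: continuous_ramp.
have E2 m : (\int[P]_w (ramp m (u w))%:E = \int[P]_w (ramp m (v w))%:E)%E.
  apply: (cvg_unique _ (lim_ramp U u m mU mu cU)) => //.
  by have := lim_ramp V v m mV mv cV; rewrite -(funext (E1 m)).
have lim_gt0 (x : T -> R) : measurable_fun setT x ->
    (\int[P]_w (ramp m (x w))%:E @[m --> \oo] --> P [set w | 0 < x w]%R)%E.
  move=> mx; have mx0 : measurable [set w | 0 < x w].
    have := mx measurableT _ (measurable_itv `]0, +oo[).
    by rewrite setTI; congr measurable; apply/seteqP; split => w/=; rewrite in_itv/= andbT.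
  rewrite -[X in P X]setIT -integral_indic//.
  apply: bounded_cvg_expectation => //; first by move=> n; exact: mc.
  by apply: aeW => w; rewrite indicE mem_setE; exact: ramp_cvg.
apply: (cvg_unique _ (lim_gt0 u mu)) => //.
by have := lim_gt0 v mv; rewrite -(funext E2).
Qed.

Section rays.
Variable n : nat.

(** A pi-system generating the product sigma-algebra.  Indexing it by lists of
    constraints makes stability under intersection a concatenation. *)
Definition rays (l : seq ('I_n * R)) : set (n.-tuple R) :=
  [set x | all (fun p => p.2 < tnth x p.1) l].

(** A single continuous function whose positivity is membership in [rays]; it
    reduces the convergence of laws of vectors to that of laws of scalars.
    The initial value 1 is any positive number. *)
Definition ray_margin (l : seq ('I_n * R)) (x : n.-tuple R) : R :=
  \big[Num.min/1]_(p <- l) (tnth x p.1 - p.2).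

Lemma ray_marginE l x : rays l x <-> 0 < ray_margin l x.
Proof.
rewrite /rays /ray_margin/=; elim: l => [|p l IH] /=.
  by rewrite big_nil ltr01.
rewrite big_cons lt_min subr_gt0; split=> [/andP[-> /IH]//|/andP[-> h]/=].
exact/IH.
Qed.

Lemma measurable_ray_margin l : measurable_fun setT (ray_margin l).
Proof.
rewrite /ray_margin; elim: l => [|p l IH].
  rewrite (_ : (fun x => _) = cst 1); first exact: measurable_cst.
  by apply/funext => x; rewrite big_nil.
rewrite (_ : (fun x => _) = fun x : n.-tuple R => Num.min (tnth x p.1 - p.2)
    (\big[Num.min/1]_(q <- l) (tnth x q.1 - q.2))); last first.
  by apply/funext => x; rewrite big_cons.
apply: measurable_minr => //; apply: measurable_funB => //.
exact: measurable_tnth.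
Qed.

Lemma measurable_rays l : measurable (rays l).
Proof.
have := measurable_ray_margin l measurableT (measurable_itv `]0, +oo[).
rewrite setTI; congr measurable; apply/seteqP; split => x/=; rewrite in_itv/= andbT.
  by move/ray_marginE.
by move=> ?; apply/ray_marginE.
Qed.

Lemma rays_generate (A : set (n.-tuple R)) :
  measurable A -> <<s range rays >> A.
Proof.
move: A; apply: smallest_sub; first exact: smallest_sigma_algebra.
rewrite -bigcup_seq/= => A [i _ [B mB]]; rewrite setTI => <-{A}.
have /= : (@RGenOInfty.G R).-sigma.-measurable B by rewrite -RGenOInfty.measurableE.
move: B {mB}; apply: smallest_sub.
  split.
  - by rewrite preimage_set0; case: (smallest_sigma_algebra setT (range rays)).
  - move=> B; rewrite setTD preimage_setC -setTD.
    by case: (smallest_sigma_algebra setT (range rays)) => _ + _; exact.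
  - move=> F mF; rewrite preimage_bigcup.
    by case: (smallest_sigma_algebra setT (range rays)) => _ _; exact.
move=> B [r ->]; apply: sub_sigma_algebra; exists [:: (i, r)] => //.
Qed.
End rays.

(** A finite family of linear combinations is a measurable image of one larger
    finite family of variables, indexed by pairs. *)
Lemma same_fdd_linear (I J : Type) (K : finType) (X X' : I -> T -> R)
    (idx : J -> K -> I) (c : J -> K -> R) :
  same_fdd P X X' ->
  same_fdd P (fun p w => \sum_(k : K) c p k * X (idx p k) w)
             (fun p w => \sum_(k : K) c p k * X' (idx p k) w).
Proof.
move=> XX' n jdx A mA.
pose KK : finType := ('I_n * K)%type.
pose L (x : #|KK|.-tuple R) : n.-tuple R :=
  [tuple \sum_(k : K) c (jdx i) k * tnth x (enum_rank (i, k)) | i < n].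
have mL : measurable_fun setT L.
  apply/measurable_fun_tnthP => i.
  rewrite (_ : _ \o _ = fun x => \sum_(k : K) c (jdx i) k * tnth x (enum_rank (i, k))).
    apply: measurable_sum => k; apply: measurable_funM => //.
    exact: measurable_tnth.
  by apply/funext => x /=; rewrite tnth_mktuple.
have mLA : measurable (L @^-1` A) by rewrite -[X in measurable X]setTI; exact: mL.
have E (Z : I -> T -> R) :
    (fun w => [tuple \sum_(k : K) c (jdx i) k * Z (idx (jdx i) k) w | i < n]) @^-1` A =
    (fun w => [tuple Z (idx (jdx (enum_val m).1) (enum_val m).2) w | m < #|KK|]) @^-1` (L @^-1` A).
  rewrite -comp_preimage; congr (_ @^-1` A); apply/funext => w /=.
  apply: eq_from_tnth => i; rewrite !tnth_mktuple.
  by apply: eq_bigr => k _; rewrite tnth_mktuple enum_rankK.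
by rewrite !E; exact: XX'.
Qed.

(** Two probability laws which agree on the pi-system [rays] are equal. *)
Lemma same_fdd_lim (I : Type) (X X' : nat -> I -> T -> R) (Y Y' : I -> T -> R) :
  (forall n p, measurable_fun setT (X n p)) -> (forall n p, measurable_fun setT (X' n p)) ->
  (forall p, measurable_fun setT (Y p)) -> (forall p, measurable_fun setT (Y' p)) ->
  (forall n, same_fdd P (X n) (X' n)) ->
  (forall p, {ae P, forall w, X n p w @[n --> \oo] --> Y p w}) ->
  (forall p, {ae P, forall w, X' n p w @[n --> \oo] --> Y' p w}) ->
  same_fdd P Y Y'.
Proof.
move=> mX mX' mY mY' XX' cX cX' n idx A mA.
have mtup (Z : I -> T -> R) : (forall p, measurable_fun setT (Z p)) ->
    measurable_fun setT (fun w => [tuple Z (idx k) w | k < n]).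
  move=> mZ; apply/measurable_fun_tnthP => i.
  rewrite (_ : _ \o _ = Z (idx i))//.
  by apply/funext => w /=; rewrite tnth_mktuple.
pose m1 : {measure set (n.-tuple R) -> \bar R} :=
  measure_function_pushforward__canonical__measure_function_Measure P (mtup _ mY).
pose m2 : {measure set (n.-tuple R) -> \bar R} :=
  measure_function_pushforward__canonical__measure_function_Measure P (mtup _ mY').
apply: (@g_sigma_algebra_measure_unique _ R _ (range (@rays n)) _ (fun=> setT) _ _ m1 m2).
- by move=> _ [l _ <-]; exact: measurable_rays.
- by move=> _; exists [::] => //; apply/seteqP; split.
- by rewrite bigcup_const//; exists 0%N.
- move=> _ _ [l _ <-] [l' _ <-]; exists (l ++ l') => //.
  by apply/seteqP; split => x; rewrite /rays/= all_cat => /andP.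
- move=> _ [l _ <-]; rewrite /m1 /m2/= /pushforward.
  have E (Z : I -> T -> R) : (fun w => [tuple Z (idx k) w | k < n]) @^-1` rays l =
      [set w | 0 < ray_margin l [tuple Z (idx k) w | k < n]].
    by apply/seteqP; split => w /= /ray_marginE.
  rewrite !E.
  have mm (Z : I -> T -> R) : (forall p, measurable_fun setT (Z p)) ->
      measurable_fun setT (fun w => ray_margin l [tuple Z (idx k) w | k < n]).
    by move=> mZ; apply: measurableT_comp; [exact: measurable_ray_margin|exact: (mtup Z mZ)].
  have cm (Z_ : nat -> I -> T -> R) (Z : I -> T -> R) :
      (forall p, {ae P, forall w, Z_ j p w @[j --> \oo] --> Z p w}) ->
      {ae P, forall w, ray_margin l [tuple Z_ j (idx k) w | k < n] @[j --> \oo]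
        --> ray_margin l [tuple Z (idx k) w | k < n]}.
    move=> cZ; rewrite /ray_margin; clear E mm; elim: l => [|p l' IH].
      by apply: aeW => w; rewrite big_nil; under eq_fun do rewrite big_nil; exact: cvg_cst.
    have := cZ (idx p.1); move: IH; apply: filterS2 => w IH cw.
    pose m j := \big[Num.min/1]_(q <- l') (tnth [tuple Z_ j (idx k) w | k < n] q.1 - q.2).
    rewrite big_cons tnth_mktuple minr_absE.
    rewrite (_ : (fun j => _) = fun j => (Z_ j (idx p.1) w - p.2 + m j -
        `|Z_ j (idx p.1) w - p.2 - m j|) / 2); last first.
      by apply/funext => j; rewrite big_cons tnth_mktuple minr_absE.
    have cp : Z_ j (idx p.1) w - p.2 @[j --> \oo] --> Z (idx p.1) w - p.2.
      by apply: cvgB => //; exact: cvg_cst.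
    apply: cvgM; last exact: cvg_cst.
    by apply: cvgB; [exact: cvgD|apply: cvg_norm; exact: cvgB].
  apply: (law_limit_gt0 (U := fun j w => ray_margin l [tuple X j (idx k) w | k < n])
    (V := fun j w => ray_margin l [tuple X' j (idx k) w | k < n])).
  + by move=> j; exact: mm.
  + by move=> j; exact: mm.
  + exact: mm.
  + exact: mm.
  + exact: cm.
  + exact: cm.
  + move=> j B mB; have mB' : measurable (ray_margin l @^-1` B).
      by rewrite -[X in measurable X]setTI; exact: measurable_ray_margin.
    exact: XX' mB'.
- by move=> _; rewrite /m1/= /pushforward preimage_setT probability_setT ltry.
- exact: rays_generate.
Qed.
End finite_dimensional_laws.

(** * Riemann-Stieltjes sums along uniform grids *)

Section pathwise_integral.
Context {R : realType}.
Notation mu := (@lebesgue_measure R).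
Implicit Types (a c t eps : R) (b f g : R -> R).

(** Heine-Cantor, from the covering form of compactness. *)
Lemma segment_unif_continuous b a c eps : continuous b -> 0 < eps ->
  exists2 delta, 0 < delta &
    forall x y, a <= x <= c -> `|y - x| < delta -> `|b y - b x| < eps.
Proof.
move=> cb eps0.
have e20 : 0 < eps / 2 by rewrite divr_gt0.
have /compact_near_coveringP cov := @segment_compact R a c.
pose Q (d : R) (x : R) := forall y, `|y - x| < d -> `|b y - b x| < eps.
have : \forall d \near (0 : R)^'+, `[a, c]%classic `<=` Q d.
  apply: cov => x _.
  have /cvgrPdist_lt/(_ _ e20)/nbhs_ballP[r /= r0 br] := cb x.
  have r20 : 0 < r / 2 by rewrite divr_gt0.
  near=> x' d => /= y yx'.
  have hx : `|x - x'| < r / 2.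
    by near: x'; exact: nbhsx_ballx.
  have hd : d < r / 2 by near: d; exact: nbhs_right_lt.
  have b1 : `|b x - b x'| < eps / 2.
    by apply: br; rewrite /ball/= (lt_trans hx)// ltr_pdivrMr// ltr_pMr// ltr1n.
  have b2 : `|b x - b y| < eps / 2.
    apply: br; rewrite /ball/=.
    have -> : x - y = (x - x') - (y - x') by ring.
    apply: le_lt_trans (ler_normB _ _) _; rewrite (splitr r).
    by apply: ltrD => //; exact: lt_trans hd.
  have -> : b y - b x' = (b x - b x') - (b x - b y) by ring.
  by apply: le_lt_trans (ler_normB _ _) _; rewrite (splitr eps) ltrD.
move=> [r /= r0 H]; exists (r / 2); first by rewrite divr_gt0.
move=> x y /andP[ax xc]; apply: H; rewrite /ball/= ?in_itv/= ?ax ?divr_gt0//.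
by rewrite sub0r normrN gtr0_norm ?divr_gt0// ltr_pdivrMr// ltr_pMr// ltr1n.
Unshelve. all: by end_near. Qed.

Definition grid a t (m k : nat) : R := a + (t - a) * k%:R / m.+1%:R.

Definition grid_sum f g a t m : R :=
  \sum_(k < m.+1) f (grid a t m k) * (g (grid a t m k.+1) - g (grid a t m k)).

Lemma grid0 a t m : grid a t m 0 = a.
Proof. by rewrite /grid mulr0 mul0r addr0. Qed.

Lemma grid_last a t m : grid a t m m.+1 = t.
Proof. by rewrite /grid -mulrA mulfV ?pnatr_eq0// mulr1 addrC subrK. Qed.

Lemma grid_step a t m k : grid a t m k.+1 - grid a t m k = (t - a) / m.+1%:R.
Proof. by rewrite /grid -natr1; field; rewrite nat1r pnatr_eq0. Qed.

Lemma grid_lt a t m k : a < t -> grid a t m k < grid a t m k.+1.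
Proof. by move=> at0; rewrite -subr_gt0 grid_step divr_gt0// subr_gt0. Qed.

Lemma grid_itv a t m k : a < t -> (k <= m.+1)%N -> a <= grid a t m k <= t.
Proof.
move=> at0 km; have ta : 0 <= t - a by rewrite subr_ge0 ltW.
rewrite /grid lerDl divr_ge0 ?mulr_ge0//= -lerBrDl ler_pdivrMr//.
by rewrite ler_wpM2l// ler_nat.
Qed.

Lemma grid_mesh a t eps : 0 < eps ->
  \forall m \near \oo, (t - a) / m.+1%:R < eps.
Proof.
move=> eps0; have : (t - a) / m.+1%:R @[m --> \oo] --> (0 : R).
  rewrite -[X in _ --> X](mulr0 (t - a)); apply: cvgM; first exact: cvg_cst.
  exact: cvg_harmonic.
by move/cvgr_lt => /(_ _ eps0).
Qed.

Lemma RS_integral_grid f g a t l : a < t -> is_RS_integral f g a t l ->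
  grid_sum f g a t m @[m --> \oo] --> l.
Proof.
move=> at0 fg; apply/cvgrPdist_lt => eps eps0.
have [delta d0 H] := fg _ eps0; near=> m.
pose s := mkseq (fun k => grid a t m k.+1) m.+1.
have s_nth k : (k < m.+1)%N -> nth t s k = grid a t m k.+1.
  by move=> km; rewrite nth_mkseq.
have as_nth k : (k < m.+1)%N -> nth t (a :: s) k = grid a t m k.
  by case: k => [|k] km; rewrite ?grid0//= s_nth// ltnW.
have -> : grid_sum f g a t m = RS_sum f g a t s (grid a t m).
  rewrite /grid_sum /RS_sum size_mkseq; apply: eq_bigr => k _.
  by rewrite s_nth// as_nth.
rewrite distrC; apply: H; split.
  split.
    apply/(pathP t) => i; rewrite size_mkseq => im.
    by rewrite s_nth// as_nth// grid_lt.
  by rewrite -nth_last size_mkseq/= (set_nth_default t) ?size_mkseq// s_nth// grid_last.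
move=> k; rewrite size_mkseq => km; rewrite s_nth// as_nth//; split => //.
  exact/ltW/grid_lt.
by rewrite grid_step; near: m; exact: grid_mesh.
Unshelve. all: by end_near. Qed.

(** Sums of [b] against the increments of the increasing function [phi].  On a
    cell where [b] oscillates by at most e1, both e1 phi + Psi - b(y) phi and
    e1 phi - Psi + b(y) phi are nondecreasing by the mean value theorem, so the
    error on the cell is at most e1 times the increment of [phi]. *)
Lemma grid_sum_smooth b phi f Psi a t : a < t -> continuous b ->
  (forall x : R, is_derive x 1 phi (f x)) -> (forall x, 0 <= f x) ->
  {within `[a, t], continuous Psi} ->
  (forall x : R, a < x < t -> is_derive x 1 Psi (b x * f x)) ->
  \sum_(k < m.+1) b (grid a t m k.+1) * (phi (grid a t m k.+1) - phi (grid a t m k))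
    @[m --> \oo] --> Psi t - Psi a.
Proof.
move=> at0 cb dphi f0 cPsi dPsi; apply/cvgrPdist_le => eps eps0.
have cphi : continuous phi.
  by move=> x; exact: is_derive_continuous (dphi x).
pose V := phi t - phi a.
have phi_le x y : x <= y -> phi x <= phi y.
  move=> xy.
  have cxy : {within `[x, y], continuous phi} by exact: continuous_subspaceT.
  have [c _ E] := MVT_segment xy (fun z _ => dphi z) cxy.
  by rewrite -subr_ge0 E mulr_ge0// subr_ge0.
have V0 : 0 <= V by rewrite subr_ge0 phi_le// ltW.
have e10 : 0 < eps / (V + 1) by rewrite divr_gt0// ltr_wpDl.
set e1 := eps / (V + 1) in e10.
have [delta d0 ub] := segment_unif_continuous a t cb e10.
near=> m.
have mesh : (t - a) / m.+1%:R < delta by near: m; exact: grid_mesh.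
have cell k : (k < m.+1)%N ->
    `|(Psi (grid a t m k.+1) - Psi (grid a t m k)) -
      b (grid a t m k.+1) * (phi (grid a t m k.+1) - phi (grid a t m k))| <=
    e1 * (phi (grid a t m k.+1) - phi (grid a t m k)).
  move=> km; set x := grid a t m k; set y := grid a t m k.+1.
  have xy : x < y by exact: grid_lt.
  have /andP[ax _] : a <= x <= t by exact: (grid_itv at0 (ltnW km)).
  have /andP[ay yt] : a <= y <= t by exact: grid_itv.
  have side (sg : R) : `|sg| = 1 ->
      0 <= e1 * (phi y - phi x) + sg * ((Psi y - Psi x) - b y * (phi y - phi x)).
    move=> sg1.
    pose G z := e1 * phi z + sg * (Psi z - b y * phi z).
    pose dG z := e1 * f z + sg * (b z * f z - b y * f z).
    have dGP z : z \in `]x, y[ -> is_derive z 1 G (dG z).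
      rewrite in_itv/= => /andP[xz zy].
      have h1 := dphi z.
      have h2 : is_derive z 1 Psi (b z * f z).
        by apply: dPsi; rewrite (le_lt_trans ax xz) (lt_le_trans zy yt).
      by apply: is_derive_eq; rewrite /GRing.scale/= /dG; ring.
    have cG : {within `[x, y], continuous G}.
      have cP : {within `[x, y], continuous Psi}.
        apply: continuous_subspaceW cPsi => z/=; rewrite !in_itv/= => /andP[xz zy].
        by rewrite (le_trans ax xz) (le_trans zy yt).
      have cp : {within `[x, y], continuous phi} by exact: continuous_subspaceT.
      move=> z; apply: cvgD; apply: cvgM; try exact: cvg_cst.
        exact: cp.
      by apply: cvgB; [exact: cP|apply: cvgM; [exact: cvg_cst|exact: cp]].
    have [c cxy E] := MVT xy dGP cG.
    have -> : e1 * (phi y - phi x) + sg * ((Psi y - Psi x) - b y * (phi y - phi x)) =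
      G y - G x by rewrite /G; ring.
    rewrite E; apply: mulr_ge0; last by rewrite subr_ge0 ltW.
    move: cxy; rewrite in_itv/= => /andP[xc cy].
    have -> : dG c = f c * (e1 + sg * (b c - b y)) by rewrite /dG; ring.
    apply: mulr_ge0 => //.
    have : `|sg * (b c - b y)| < e1.
      rewrite normrM sg1 mul1r; apply: ub; first by rewrite ay.
      rewrite ltr0_norm ?subr_lt0// opprB; apply: lt_trans mesh.
      by rewrite -(grid_step a t m k) ltrD2l ltrN2.
    by rewrite ltr_norml => /andP[h _]; lra.
  have := side 1 (normr1 _); have := side (-1); rewrite normrN normr1 => /(_ erefl).
  rewrite mul1r mulN1r => h1 h2; rewrite ler_norml; apply/andP; split; lra.
have tel (F : R -> R) : F t - F a =
    \sum_(k < m.+1) (F (grid a t m k.+1) - F (grid a t m k)).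
  rewrite -(big_mkord xpredT (fun k => F (grid a t m k.+1) - F (grid a t m k))).
  by rewrite (telescope_sumr (fun k => F (grid a t m k)))// grid_last grid0.
rewrite (tel Psi) -sumrB; apply: le_trans (ler_norm_sum _ _ _) _.
apply: (@le_trans _ _ (\sum_(k < m.+1)
    e1 * (phi (grid a t m k.+1) - phi (grid a t m k)))).
  by apply: ler_sum => k _; exact: cell.
rewrite -mulr_sumr -(tel phi) -/V /e1 mulrAC ler_pdivrMr ?ltr_wpDl//.
by rewrite ler_wpM2l ?(ltW eps0)// lerDl.
Unshelve. all: by end_near. Qed.

(** The value of the Riemann-Stieltjes integral of e^{-alpha (t - u)} against b
    over [t - N, t] after integration by parts. *)
Definition RS_exp_formula (alpha : R) b t N : R :=
  expR (- alpha * N) * (b t - b (t - N)) +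
  \int[mu]_(z in `[0, N]) (exponential_pdf alpha z * (b t - b (t - z))).

Lemma integrable_exp_increment (alpha : R) b t N : 0 < alpha -> continuous b ->
  mu.-integrable `[0, N]
    (EFin \o (fun z => exponential_pdf alpha z * (b t - b (t - z)))).
Proof.
move=> alpha0 cb.
apply: (@eq_integrable _ _ _ mu _ _
  (EFin \o (fun z => (alpha * expR (- alpha * z)) * (b t - b (t - z))))) => //.
  by move=> z; rewrite inE/= in_itv/= => /andP[z0 _]; rewrite exponential_pdfE.
apply: continuous_compact_integrable; first exact: segment_compact.
apply: continuous_subspaceT => z.
apply: (@continuousM R R (fun z => alpha * expR (- alpha * z)) (fun z => b t - b (t - z))).
  apply: (@continuousM R R (fun=> alpha) (fun z => expR (- alpha * z))); first exact: cvg_cst.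
  exact: is_derive_continuous (is_derive_expRM _ _).
apply: cvgB; first exact: cvg_cst.
apply: (@continuous_comp _ _ _ (fun z => t - z) b); last exact: cb.
by apply: cvgB; [exact: cvg_cst|exact: cvg_id].
Qed.

(** Summation by parts, centered at b(t) so that the boundary term at t
    disappears. *)
Lemma grid_sum_exp (alpha : R) b t N : 0 < alpha -> 0 < N -> continuous b ->
  grid_sum (fun u => expR (- alpha * (t - u))) b (t - N) t m @[m --> \oo]
    --> RS_exp_formula alpha b t N.
Proof.
move=> alpha0 N0 cb.
pose a := t - N; have at0 : a < t by rewrite ltrBlDr ltrDl.
pose beta u := b u - b t.
pose phi u : R := expR (- alpha * (t - u)).
have cbeta : continuous beta.
  by move=> u; apply: cvgB; [exact: cb|exact: cvg_cst].
have dphi (x : R) : is_derive x 1 phi (alpha * phi x).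
  have h1 : is_derive x 1 (fun u => - alpha * (t - u)) alpha.
    by apply: is_derive_eq; rewrite /GRing.scale/=; ring.
  have := @is_derive1_comp R expR (fun u => - alpha * (t - u)) x (phi x) alpha.
  by rewrite [alpha * phi x]mulrC; apply; exact: is_derive_expR.
pose G x := \int[mu]_(z in `[0, x]) (exponential_pdf alpha z * (b t - b (t - z))).
pose Psi u := G (t - u).
have iG := integrable_exp_increment t _ alpha0 cb.
have dG (x : R) : 0 < x -> is_derive x 1 G (exponential_pdf alpha x * (b t - b (t - x))).
  move=> x0; have x1 : x < x + 1 by rewrite ltrDl.
  have cf : {for x, continuous (fun z => exponential_pdf alpha z * (b t - b (t - z)))}.
    apply: continuousM; first by apply: in_continuous_exponential_pdf; rewrite in_itv/= x0.
    apply: cvgB; first exact: cvg_cst.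
    apply: (@continuous_comp _ _ _ (fun z => t - z) b); last exact: cb.
    by apply: cvgB; [exact: cvg_cst|exact: cvg_id].
  have [d e] := continuous_FTC1_closed x1 (iG _) x0 cf.
  by split; [exact: d|rewrite -derive1E; exact: e].
have dPsi (x : R) : a < x < t -> is_derive x 1 Psi (beta x * (alpha * phi x)).
  move=> /andP[ax xt]; have tx0 : 0 < t - x by rewrite subr_gt0.
  have h1 : is_derive x 1 (fun u => t - u) (- 1).
    have := is_deriveB (is_derive_cst t x (1 : R)) (is_derive_id x (1 : R)).
    by rewrite sub0r.
  have := @is_derive1_comp R G (fun u => t - u) x _ _ (dG _ tx0) h1.
  rewrite exponential_pdfE ?ltW// (_ : t - (t - x) = x); last by ring.
  by rewrite (_ : _ * -1 = beta x * (alpha * phi x)) //; rewrite /beta /phi; ring.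
have cPsi : {within `[a, t], continuous Psi}.
  have ctm : continuous (fun u : R => t - u).
    by move=> u; apply: cvgB; [exact: cvg_cst|exact: cvg_id].
  apply: derivable_oo_LRcontinuous_within; split.
  - by move=> x; rewrite in_itv/= => xat; case: (dPsi x xat).
  - apply: cvg_at_right_filter.
    apply: (@continuous_comp _ _ _ (fun u => t - u) G); first exact: ctm.
    by apply: is_derive_continuous (dG _ _); rewrite subr_gt0.
  - apply: cvg_at_left_filter; rewrite /Psi subrr {2}/G set_itv1 Rintegral_set1.
    apply: (@cvg_comp _ _ _ (fun u => t - u) G _ (nbhs (0 : R))).
      by have := ctm t; rewrite /continuous_at subrr; exact.
    exact: (parameterized_integral_cvg_left ltr01 (iG _)).
have lim := grid_sum_smooth at0 cbeta dphi (fun x => mulr_ge0 (ltW alpha0) (expR_ge0 _)) cPsi dPsi.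
have E m : grid_sum phi b a t m = expR (- alpha * N) * (b t - b a) -
    \sum_(k < m.+1) beta (grid a t m k.+1) * (phi (grid a t m k.+1) - phi (grid a t m k)).
  have -> : expR (- alpha * N) * (b t - b a) =
      \sum_(k < m.+1) (phi (grid a t m k.+1) * beta (grid a t m k.+1) -
        phi (grid a t m k) * beta (grid a t m k)).
    rewrite -(big_mkord xpredT (fun k => phi (grid a t m k.+1) * beta (grid a t m k.+1) -
        phi (grid a t m k) * beta (grid a t m k))).
    rewrite (telescope_sumr (fun k => phi (grid a t m k) * beta (grid a t m k)))//.
    rewrite grid_last grid0 /beta subrr mulr0 sub0r -mulrN opprB.
    by rewrite /phi (_ : t - a = N)// /a; ring.
  rewrite -sumrB /grid_sum; apply: eq_bigr => k _; rewrite /beta; ring.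
have EG : G N = - (Psi t - Psi a).
  rewrite /Psi subrr {2}/G set_itv1 Rintegral_set1 sub0r opprK.
  by congr G; rewrite /a; ring.
rewrite (funext E) /RS_exp_formula -/a -/(G N) EG.
by apply: cvgB; [exact: cvg_cst|exact: lim].
Qed.
End pathwise_integral.

(** * The improper integral as an exponential mean of increments *)

Section improper_integral.
Context {R : realType}.
Notation mu := (@lebesgue_measure R).
Implicit Types (a c t alpha l : R) (b f g : R -> R).

Lemma improper_RS_formula alpha b t l : 0 < alpha -> continuous b ->
  is_improper_RS_integral (fun u => expR (- alpha * (t - u))) b t l ->
  RS_exp_formula alpha b t N @[N --> +oo%R] --> l.
Proof.
move=> alpha0 cb [J JP Jl].
have : J (t - N) @[N --> +oo%R] --> l.
  have := (cvgNy_compNP J (nbhs l)).1 Jl => JN.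
  rewrite (_ : (fun N => _) = (J \o -%R) \o (fun N => - t + N)).
    by apply: cvg_comp JN; exact: cvg_addrl.
  by apply/funext => N /=; congr J; ring.
apply: cvg_trans; apply: near_eq_cvg; near=> N.
have N0 : 0 < N by near: N; exact: nbhs_pinfty_gt.
have lim1 := @grid_sum_exp R alpha b t N alpha0 N0 cb.
have tN : t - N < t by rewrite ltrBlDr ltrDl.
have lim2 := RS_integral_grid tN (JP _ (ltW tN)).
by apply: (cvg_unique _ lim2 lim1).
Unshelve. all: by end_near. Qed.

Lemma integrable_cvg_pinfty_eq0 g c : mu.-integrable setT (EFin \o g) ->
  g x @[x --> +oo%R] --> c -> c = 0.
Proof.
move=> ig gc; apply/eqP; apply/negPn/negP => c0.
have c20 : 0 < `|c| / 2 by rewrite divr_gt0// normr_gt0.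
have [M [_ MP]] : \forall x \near +oo%R, `|c| / 2 < `|g x|.
  have : `|g x| @[x --> +oo%R] --> `|c| by exact: cvg_norm.
  by move/cvgr_gt; apply; rewrite ltr_pdivrMr// ltr_pMr ?normr_gt0// ltr1n.
have : (\int[mu]_(x in `]M, +oo[) (`|c| / 2)%:E < +oo)%E.
  apply: (@le_lt_trans _ _ (\int[mu]_(x in `]M, +oo[) `|(EFin \o g) x|)%E).
    apply: ge0_le_integral => //.
    - apply: measurableT_comp => //; apply: measurable_funTS.
      exact: (measurable_int mu ig).
    - move=> x; rewrite /= in_itv/= andbT => Mx; rewrite lee_fin ltW//.
      exact: MP.
  move/integrableP : ig => [mg]; apply: le_lt_trans.
  apply: ge0_subset_integral => //.
  exact: measurableT_comp.
have E : mu `]M, +oo[%classic = +oo%E.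
  by rewrite lebesgue_measure_itv/= ltry addye.
by rewrite integral_cst//= E gt0_muley ?lte_fin// ltxx.
Qed.

(** By [improper_RS_formula] the boundary term has a limit; it is the integrand
    at N divided by alpha, so that limit is 0 by
    [integrable_cvg_pinfty_eq0]. *)
Lemma improper_RS_value alpha b t l : 0 < alpha -> continuous b ->
  mu.-integrable setT (EFin \o (fun x => exponential_pdf alpha x * (b t - b (t - x)))) ->
  is_improper_RS_integral (fun u => expR (- alpha * (t - u))) b t l ->
  l = exp_mean alpha (fun x => b t - b (t - x)).
Proof.
move=> alpha0 cb ig /(improper_RS_formula alpha0 cb) cl.
set g := (fun x => _) in ig.
pose G N := \int[mu]_(z in `[0, N]) g z.
have cG : G N @[N --> +oo%R] --> \int[mu]_x g x.
  apply/cvg_pinftyP => u uy.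
  rewrite (_ : (fun n => _) = (fun n => fine (\int[mu]_x (((g \_ `[0, u n]) x)%:E))%E)); last first.
    by apply/funext => n; rewrite /G Rintegral_mkcond.
  apply: fine_cvg; rewrite fineK; last exact: integrable_fin_num.
  have mg : measurable_fun setT g by move/measurable_EFinP : (measurable_int mu ig).
  have [||||//|_ _] := @dominated_convergence _ _ R mu setT measurableT
    (fun n x => ((g \_ `[0, u n]) x)%:E) (fun x => (g x)%:E) (fun x => `|g x|%:E).
  - move=> n; apply/measurable_EFinP.
    by apply/(measurable_restrictT _ _).1 => //; exact: measurable_funTS.
  - exact: (measurable_int mu ig).
  - apply: aeW => x _; apply: cvg_EFin; first exact: nearW.
    apply: cvg_near_cst; have [x0|x0] := ltP x 0.
      near=> n; rewrite /= patchE; case: ifPn => // _.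
      by rewrite /g lt0_exponential_pdf// mul0r.
    move/cvgryPge : uy => /(_ x) [n0 _ n0P].
    exists n0 => // n /n0P xu; rewrite /= patchE mem_set//=.
    by rewrite in_itv/= x0.
  - exact: integrable_norm ig.
  - apply: aeW => x n _; rewrite lee_fin patchE; case: ifPn => // _.
    by rewrite normr0.
  - exact.
have : exponential_pdf alpha N * (b t - b (t - N)) @[N --> +oo%R] -->
    alpha * (l - \int[mu]_x g x).
  have : alpha * (RS_exp_formula alpha b t N - G N) @[N --> +oo%R] -->
      alpha * (l - \int[mu]_x g x).
    by apply: cvgM; [exact: cvg_cst|exact: cvgB].
  apply: cvg_trans; apply: near_eq_cvg; near=> N.
  have N0 : 0 <= N by near: N; exact: nbhs_pinfty_ge.
  by rewrite exponential_pdfE// /RS_exp_formula addrK mulrA.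
move=> /(integrable_cvg_pinfty_eq0 ig)/eqP.
by rewrite mulf_eq0 gt_eqF//= subr_eq0 => /eqP.
Unshelve. all: by end_near. Qed.
End improper_integral.

(** * Random fields with square-integrable sections *)

Section random_field.
Context (dT : measure_display) (T : measurableType dT) (R : realType).
Variable P : probability T R.
Notation mu := (@lebesgue_measure R).

Definition quad_field (f : T * R -> R) := measurable_fun setT f /\
  exists A, forall x, (\int[P]_w (f (w, x) ^+ 2)%:E <= (A * (1 + x ^+ 2))%:E)%E.

Lemma quad_field_measurable2 f x : quad_field f -> measurable_fun setT (fun w => f (w, x)).
Proof. by move=> [mf _]; exact: (measurableT_comp mf (pair2_measurable x)). Qed.

Lemma quad_field_cst1 : quad_field (cst 1).
Proof.
split => //; exists 1 => x; rewrite mul1r.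
under eq_integral do rewrite expr1n.
by rewrite integral_cst//= probability_setT mule1 lee_fin lerDl sqr_ge0.
Qed.

Lemma quad_field_expect_norm f g : quad_field f -> quad_field g ->
  exists2 C, 0 <= C & forall x y, (\int[P]_w `|f (w, x) * g (w, y)|%:E <=
    (C * (1 + x ^+ 2) * (1 + y ^+ 2))%:E)%E.
Proof.
move=> qf qg; have [mf [A fA]] := qf; have [mg [B gB]] := qg.
have bound0 (h : T * R -> R) M :
    (forall x, (\int[P]_w (h (w, x) ^+ 2)%:E <= (M * (1 + x ^+ 2))%:E)%E) -> 0 <= M.
  move=> /(_ 0); rewrite expr0n/= addr0 mulr1 -lee_fin; apply: le_trans.
  by apply: integral_ge0 => w _; rewrite lee_fin sqr_ge0.
have A0 := bound0 _ _ fA; have B0 := bound0 _ _ gB.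
exists (A + B); first exact: addr_ge0.
move=> x y.
have mfx := quad_field_measurable2 x qf; have mgy := quad_field_measurable2 y qg.
have mfx2 : measurable_fun setT (fun w => (f (w, x) ^+ 2)%:E).
  by apply/measurable_EFinP; exact: measurable_funX.
have mgy2 : measurable_fun setT (fun w => (g (w, y) ^+ 2)%:E).
  by apply/measurable_EFinP; exact: measurable_funX.
apply: (@le_trans _ _ (\int[P]_w ((f (w, x) ^+ 2)%:E + (g (w, y) ^+ 2)%:E))%E).
  apply: ge0_le_integral => //.
  - by apply/measurable_EFinP; apply: measurableT_comp => //; exact: measurable_funM.
  - exact: emeasurable_funD.
  - move=> w _; rewrite -EFinD lee_fin normrM.
    rewrite -[f _ ^+ 2]real_normK ?num_real// -[g _ ^+ 2]real_normK ?num_real//.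
    have := sqr_ge0 (`|f (w, x)| - `|g (w, y)|).
    by have := mulr_ge0 (normr_ge0 (f (w, x))) (normr_ge0 (g (w, y))); rewrite !expr2; nra.
rewrite ge0_integralD//; last 2 first.
- by move=> w _; rewrite lee_fin sqr_ge0.
- by move=> w _; rewrite lee_fin sqr_ge0.
apply: le_trans (leeD (fA x) (gB y)) _; rewrite -EFinD lee_fin.
have := mulr_ge0 A0 (sqr_ge0 x); have := mulr_ge0 A0 (sqr_ge0 y).
have := mulr_ge0 B0 (sqr_ge0 x); have := mulr_ge0 B0 (sqr_ge0 y).
have := mulr_ge0 (addr_ge0 A0 B0) (mulr_ge0 (sqr_ge0 x) (sqr_ge0 y)).
rewrite !expr2; nra.
Qed.

Lemma measurable_exp_mean_field a (f : T * R -> R) : measurable_fun setT f ->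
  measurable_fun setT (fun w => exp_mean a (fun x => f (w, x))).
Proof.
move=> mf; apply: (@measurable_Rintegral_param _ _ _ _ _ mu
  (fun z : T * R => exponential_pdf a z.2 * f z)).
apply: measurable_funM => //; apply: measurableT_comp => //.
exact: measurable_exponential_pdf.
Qed.

Section mean_of_field.
Variables (a : R) (f : T * R -> R) (Q : T -> R) (C : R).
Hypotheses (a0 : 0 < a) (mf : measurable_fun setT f) (mQ : measurable_fun setT Q).
Hypothesis QfC : forall x,
  (\int[P]_w `|Q w * f (w, x)|%:E <= (C * (1 + x ^+ 2))%:E)%E.

Let h (z : T * R) : R := exponential_pdf a z.2 * (Q z.1 * f z).

Let mh : measurable_fun setT h.
Proof.
apply: measurable_funM.
  by apply: measurableT_comp => //; exact: measurable_exponential_pdf.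
by apply: measurable_funM => //; exact: measurableT_comp.
Qed.

Let mQf x : measurable_fun setT (fun w => Q w * f (w, x)).
Proof. by apply: measurable_funM => //; exact: (measurableT_comp mf (pair2_measurable x)). Qed.

Let h_bound : (\int[mu]_x \int[P]_w `|h (w, x)|%:E <=
  (exp_mean a (fun x => C * (1 + x ^+ 2)))%:E)%E.
Proof.
have iq := integrable_exponential_quad a0 (quad_growth_sqr C).
rewrite /exp_mean /Rintegral fineK; last exact: (integrable_fin_num measurableT iq).
apply: ge0_le_integral => //.
- by move=> x _; exact: integral_ge0.
- have mh' : measurable_fun setT (fun z => `|(EFin \o h) z|%E).
    by apply: measurableT_comp => //; exact/measurable_EFinP.
  exact: (@measurable_fun_fubini_tonelli_G _ _ _ _ _ P _ mh' (fun=> abse_ge0 _)).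
- exact: (measurable_int mu iq).
- move=> x _; have e0 := exponential_pdf_ge0 (ltW a0) x.
  under eq_integral do rewrite /h/= normrM (ger0_norm e0) EFinM.
  rewrite ge0_integralZl//; last first.
    by apply/measurable_EFinP; apply: measurableT_comp => //; exact: mQf.
  by rewrite EFinM lee_wpmul2l.
Qed.

Lemma integrable_field_product : (P \x mu)%E.-integrable setT (EFin \o h).
Proof.
apply/integrable21ltyP; first exact/measurable_EFinP.
by apply: le_lt_trans h_bound _; exact: ltry.
Qed.

(** The absolute value bound is what allows the lemmas of this section to be
    iterated, with [Q] itself the exponential mean of a second field. *)
Lemma mean_of_field_norm :
  (\int[P]_w `|Q w * exp_mean a (fun x => f (w, x))|%:E <=
   (exp_mean a (fun x => C * (1 + x ^+ 2)))%:E)%E.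
Proof.
apply: le_trans h_bound.
have mh' : measurable_fun setT (fun z => `|(EFin \o h) z|%E).
  by apply: measurableT_comp => //; exact/measurable_EFinP.
have := @fubini_tonelli _ _ _ _ _ P mu _ mh' (fun=> abse_ge0 _).
rewrite /= => <-.
apply: ge0_le_integral => //.
- apply/measurable_EFinP; apply: measurableT_comp => //; apply: measurable_funM => //.
  exact: measurable_exp_mean_field.
- exact: (@measurable_fun_fubini_tonelli_F _ _ _ _ _ mu _ mh' (fun=> abse_ge0 _)).
- move=> w _; rewrite /h/= normrM EFinM.
  have mfw : measurable_fun setT (fun x => exponential_pdf a x * f (w, x)).
    apply: measurable_funM; first exact: measurable_exponential_pdf.
    exact: (measurableT_comp mf (pair1_measurable w)).
  have mfwE : measurable_fun setT (fun x => `|exponential_pdf a x * f (w, x)|%:E).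
    by apply/measurable_EFinP; exact: measurableT_comp.
  have -> : (\int[mu]_x `|exponential_pdf a x * (Q w * f (w, x))|%:E =
      `|Q w|%:E * \int[mu]_x `|exponential_pdf a x * f (w, x)|%:E)%E.
    rewrite -ge0_integralZl//; apply: eq_integral => x _.
    by rewrite -EFinM -normrM mulrCA.
  apply: lee_wpmul2l; first by rewrite lee_fin.
  rewrite /exp_mean /Rintegral.
  have mfwE0 : measurable_fun setT (fun x => (exponential_pdf a x * f (w, x))%:E).
    exact/measurable_EFinP.
  have := le_abse_integral mu measurableT mfwE0.
  apply: le_trans; case: (\int[mu]_x _)%E => [r| |] //=; by rewrite ?normr0 leey.
Qed.

Lemma integrable_mean_of_field :
  P.-integrable setT (fun w => (Q w * exp_mean a (fun x => f (w, x)))%:E).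
Proof.
apply/integrableP; split.
  apply/measurable_EFinP; apply: measurable_funM => //.
  exact: measurable_exp_mean_field.
by apply: le_lt_trans mean_of_field_norm _; exact: ltry.
Qed.

Hypothesis fint : {ae P, forall w,
  mu.-integrable setT (fun x => (exponential_pdf a x * f (w, x))%:E)}.

Lemma expect_mean_of_field :
  (\int[P]_w (Q w * exp_mean a (fun x => f (w, x)))%:E =
   (exp_mean a (fun x => fine (\int[P]_w (Q w * f (w, x))%:E)))%:E)%E.
Proof.
have ih := integrable_field_product.
have F := Fubini ih.
transitivity (\int[P]_w \int[mu]_x (EFin \o h) (w, x))%E.
  apply: ae_eq_integral => //.
  - exact: (measurable_int P integrable_mean_of_field).
  - exact: (measurable_fubini_F ih).
  - move: fint; apply: filterS => w iw _.
    rewrite EFinM /exp_mean /Rintegral fineK; last exact: (integrable_fin_num measurableT iw).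
    rewrite -integralZl//; apply: eq_integral => x _ /=.
    by rewrite /h/= -EFinM mulrCA.
rewrite F.
have E x : (\int[P]_w (EFin \o h) (w, x) =
    (exponential_pdf a x * fine (\int[P]_w (Q w * f (w, x))%:E))%:E)%E.
  have iQ : P.-integrable setT (fun w => (Q w * f (w, x))%:E).
    apply/integrableP; split; first by apply/measurable_EFinP; exact: mQf.
    by apply: le_lt_trans (QfC x) _; exact: ltry.
  rewrite EFinM fineK; last exact: integrable_fin_num.
  by rewrite -integralZl//; apply: eq_integral => w _ /=; rewrite /h/= EFinM.
under eq_integral do rewrite E.
rewrite /exp_mean /Rintegral fineK//.
have qc : quad_growth (fun x => fine (\int[P]_w (Q w * f (w, x))%:E)).
  split.
    apply: (@measurable_Rintegral_param _ _ _ _ _ P (fun z : R * T => Q z.2 * f (z.2, z.1))).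
    apply: measurable_funM; first exact: measurableT_comp.
    by apply: (measurableT_comp mf); exact: measurable_fun_pair.
  exists C => x; rewrite -lee_fin; apply: le_trans (QfC x).
  have mQE : measurable_fun setT (fun w => (Q w * f (w, x))%:E).
    by apply/measurable_EFinP; exact: mQf.
  have := le_abse_integral P measurableT mQE.
  apply: le_trans; case: (\int[P]_w _)%E => [r| |] //=; by rewrite ?normr0 leey.
exact: (integrable_fin_num measurableT (integrable_exponential_quad a0 qc)).
Qed.
End mean_of_field.
End random_field.

(** * Means of products, continuous processes, centered Gaussian variables *)

Section field_pairs.
Context (dT : measure_display) (T : measurableType dT) (R : realType).
Variable P : probability T R.
Notation mu := (@lebesgue_measure R).

Lemma quad_field_norm_bound (f : T * R -> R) : quad_field P f ->
  exists2 C, 0 <= C &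
    forall x, (\int[P]_w `|1 * f (w, x)|%:E <= (C * (1 + x ^+ 2))%:E)%E.
Proof.
move=> qf; have [C C0 fC] := quad_field_expect_norm qf (quad_field_cst1 P).
exists C => // x; apply: le_trans (_ : (_ <= (C * (1 + x ^+ 2) * (1 + 0 ^+ 2))%:E)%E) _.
  apply: le_trans (fC x 0); apply: ge0_le_integral => //.
  - apply/measurable_EFinP; apply: measurableT_comp => //; apply: measurable_funM => //.
    exact: quad_field_measurable2 qf.
  - apply/measurable_EFinP; apply: measurableT_comp => //; apply: measurable_funM => //.
    exact: quad_field_measurable2 qf.
  - by move=> w _; rewrite lee_fin mulrC.
by rewrite expr0n/= addr0 mulr1.
Qed.

Lemma quad_field_ae_integrable a (f : T * R -> R) : 0 < a -> quad_field P f ->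
  {ae P, forall w, mu.-integrable setT (fun x => (exponential_pdf a x * f (w, x))%:E)}.
Proof.
move=> a0 qf; have [C C0 fC] := quad_field_norm_bound qf; have [mf _] := qf.
have := @ae_integrable1 _ _ _ _ _ P mu _
  (integrable_field_product a0 mf (measurable_cst (1 : R)) fC).
by apply: filterS => w; under eq_fun do rewrite /= mul1r.
Qed.

Lemma quad_field_integrable_mean a (f : T * R -> R) : 0 < a -> quad_field P f ->
  P.-integrable setT (fun w => (exp_mean a (fun x => f (w, x)))%:E).
Proof.
move=> a0 qf; have [C C0 fC] := quad_field_norm_bound qf; have [mf _] := qf.
have := integrable_mean_of_field a0 mf (measurable_cst (1 : R)) fC.
by under eq_fun do rewrite /= mul1r.
Qed.

Lemma quad_field_expect_mean a (f : T * R -> R) : 0 < a -> quad_field P f ->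
  (\int[P]_w (exp_mean a (fun x => f (w, x)))%:E =
   (exp_mean a (fun x => fine (\int[P]_w (f (w, x))%:E)))%:E)%E.
Proof.
move=> a0 qf; have [C C0 fC] := quad_field_norm_bound qf; have [mf _] := qf.
have := expect_mean_of_field a0 mf (measurable_cst (1 : R)) fC
  (quad_field_ae_integrable a0 qf).
under eq_integral do rewrite /= mul1r.
move=> ->; congr (_%:E); apply: exp_mean_eq => x _; apply: (congr1 fine).
by apply: eq_integral => w _; rewrite /= mul1r.
Qed.

Section mean_pair.
Variables (a b : R) (f g : T * R -> R).
Hypotheses (a0 : 0 < a) (b0 : 0 < b) (qf : quad_field P f) (qg : quad_field P g).
Let V w := exp_mean b (fun y => g (w, y)).

Let mf : measurable_fun setT f. Proof. by case: qf. Qed.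

Let mg : measurable_fun setT g. Proof. by case: qg. Qed.

Let mV : measurable_fun setT V.
Proof. exact: measurable_exp_mean_field. Qed.

Let VfC : exists C, forall x,
  (\int[P]_w `|V w * f (w, x)|%:E <= (C * (1 + x ^+ 2))%:E)%E.
Proof.
have [C C0 fgC] := quad_field_expect_norm qf qg.
exists (C * exp_mean b (fun y => 1 * (1 + y ^+ 2))) => x.
under eq_integral do rewrite mulrC.
apply: le_trans (mean_of_field_norm b0 mg (quad_field_measurable2 x qf) (fgC x)) _.
rewrite lee_fin (_ : (fun y => _) = (fun y => (C * (1 + x ^+ 2)) * (1 * (1 + y ^+ 2)))).
  have -> : exp_mean b (fun y => (C * (1 + x ^+ 2)) * (1 * (1 + y ^+ 2))) =
      (C * (1 + x ^+ 2)) * exp_mean b (fun y => 1 * (1 + y ^+ 2)).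
    by apply: exp_meanZ => //; exact: quad_growth_sqr.
  by rewrite mulrAC.
by apply/funext => y; rewrite mul1r.
Qed.

Lemma integrable_exp_mean2 : P.-integrable setT
  (fun w => (exp_mean a (fun x => f (w, x)) * exp_mean b (fun y => g (w, y)))%:E).
Proof.
have [C fC] := VfC; have := integrable_mean_of_field a0 mf mV fC.
by under eq_fun do rewrite mulrC.
Qed.

(** Fubini is used once for each factor: first with [Q] the mean of [g], then
    with [Q] the variable f(., x). *)
Lemma quad_field_expect_mean2 :
  (\int[P]_w (exp_mean a (fun x => f (w, x)) * exp_mean b (fun y => g (w, y)))%:E =
   (exp_mean a (fun x => exp_mean b (fun y =>
      fine (\int[P]_w (f (w, x) * g (w, y))%:E))))%:E)%E.
Proof.
have [C C0 fgC] := quad_field_expect_norm qf qg.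
have [C' fC'] := VfC.
have := expect_mean_of_field a0 mf mV fC' (quad_field_ae_integrable a0 qf).
under eq_integral do rewrite mulrC.
move=> ->; congr (_%:E); apply: exp_mean_eq => x _.
have := expect_mean_of_field b0 mg (quad_field_measurable2 x qf) (fgC x)
  (quad_field_ae_integrable b0 qg).
under eq_integral do rewrite mulrC.
by move=> ->.
Qed.
End mean_pair.

Lemma covariance_centered (X Y : T -> R) :
  (\int[P]_w (X w)%:E = 0)%E -> (\int[P]_w (Y w)%:E = 0)%E ->
  covariance P X Y = (\int[P]_w (X w * Y w)%:E)%E.
Proof.
move=> X0 Y0; have EX : ('E_P[X] = 0)%E by rewrite unlock.
have EY : ('E_P[Y] = 0)%E by rewrite unlock.
rewrite covariance.unlock EX EY unlock.
by apply: eq_integral => w _; rewrite !fctE/= !subr0.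
Qed.

End field_pairs.

Section continuous_process.
Context (dT : measure_display) (T : measurableType dT) (R : realType).

(** The process is the pointwise limit of its values at the times
    floor((n + 1) t) / (n + 1), which are piecewise constant in t. *)
Lemma measurable_continuous_process (X : R -> T -> R) :
  (forall t, measurable_fun setT (X t)) -> (forall w, continuous (fun t => X t w)) ->
  measurable_fun setT (fun z : T * R => X z.2 z.1).
Proof.
move=> mX cX.
pose fl (n : nat) (t : R) : int := Num.floor (n.+1%:R * t).
pose Xn n (z : T * R) := X ((fl n z.2)%:~R / n.+1%:R) z.1.
apply: (@measurable_fun_cvg _ _ _ setT Xn) => //.
- move=> n _ Y mY; rewrite setTI.
  rewrite (_ : _ @^-1` _ = \bigcup_(k : int) ((X (k%:~R / n.+1%:R) @^-1` Y) `*`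
      `[k%:~R / n.+1%:R, (k + 1)%:~R / n.+1%:R[%classic)).
    apply: countable_bigcupT_measurable => // k; apply: measurableX.
      by rewrite -[X in measurable X]setTI; exact: mX.
    exact: measurable_itv.
  have flE k t : (fl n t == k) = (k%:~R / n.+1%:R <= t < (k + 1)%:~R / n.+1%:R).
    by rewrite /fl floor_eq ler_pdivrMr// ltr_pdivlMr// mulrC.
  apply/seteqP; split => [[w t] /= Yw|[w t] [k _] /= [Yw]].
    exists (fl n t) => //; split => //=.
    by rewrite in_itv/= -flE eqxx.
  by rewrite in_itv/= -flE => /eqP E; rewrite /Xn/= E.
- move=> [w t] _ /=.
  apply: (@continuous_cvg _ _ _ _ _ _ (fun t => X t w)); first exact: cX.
  apply/cvgrPdist_lt => e e0; near=> n.
  have /andP[f1 f2] := floor_itv (n.+1%:R * t).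
  have n0 : (0 : R) < n.+1%:R by [].
  have E : t - (fl n t)%:~R / n.+1%:R = (n.+1%:R * t - (fl n t)%:~R) / n.+1%:R.
    by field; rewrite gt_eqF.
  rewrite E ger0_norm; last by rewrite divr_ge0// subr_ge0.
  apply: (@lt_trans _ _ (n.+1%:R^-1)).
    rewrite -[X in _ < X]mul1r ltr_pM2r ?invr_gt0//.
    by rewrite ltrBlDr addrC -(intrD _ _ 1).
  by near: n; exact: (near_infty_natSinv_lt (PosNum e0)).
Unshelve. all: by end_near. Qed.
End continuous_process.

Section gaussian_mean.
Context (dT : measure_display) (T : measurableType dT) (R : realType).
Variable P : probability T R.
Notation mu := (@lebesgue_measure R).

Lemma normal_prob_opp (s : R) (A : set R) : s != 0 -> measurable A ->
  normal_prob 0 s (-%R @^-1` A) = normal_prob 0 s A.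
Proof.
move=> s0 mA; rewrite /normal_prob.
have mn : measurable_fun setT (fun x : R => (normal_pdf 0 s x)%:E).
  by apply/measurable_EFinP; exact: measurable_normal_pdf.
have pdfN x : normal_pdf 0 s (- x) = normal_pdf 0 s x.
  by rewrite /normal_pdf (negbTE s0) /normal_fun !subr0 sqrrN.
rewrite [RHS](eq_measure_integral (pushforward mu (-%R : _ -> measurableTypeR R))); last first.
  by move=> B mB _; exact/esym/lebesgue_measureN.
rewrite ge0_integral_pushforward; last 4 first.
- exact: (@oppr_measurable R setT).
- exact: mA.
- exact: measurable_funTS.
- by move=> x _; rewrite lee_fin normal_pdf_ge0.
by apply: eq_integral => x _; rewrite /= pdfN.
Qed.

(** The law is symmetric, so the mean equals its opposite. *)
Lemma centered_gaussian_mean0 (X : {RV P >-> R}) : centered_gaussian P X ->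
  P.-integrable setT (EFin \o X) -> (\int[P]_w (X w)%:E = 0)%E.
Proof.
move=> gX iX.
have sym (A : set R) : measurable A -> P (X @^-1` A) = P (X @^-1` (-%R @^-1` A)).
  move=> mA; have mNA : measurable ((-%R : R -> R) @^-1` A).
    by rewrite -[X in measurable X]setTI; exact: (@oppr_measurable R setT).
  case: gX => [H|[s s0 H]]; rewrite !H//.
    rewrite !diracE (_ : (0 \in -%R @^-1` A) = (0 \in A))//.
    by apply/idP/idP; rewrite !inE/= oppr0.
  by rewrite normal_prob_opp// gt_eqF.
have mX : measurable_fun setT X by exact: measurable_funPT.
have iN : P.-integrable setT (EFin \o (fun w => - X w)).
  by have := integrableN iX; apply: eq_integrable.
have mNX : measurable_fun setT (fun w => - X w) by exact: measurableT_comp.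
have mid : measurable_fun setT (@EFin R) by exact/measurable_EFinP.
have E : (\int[P]_w (X w)%:E = \int[P]_w (- X w)%:E)%E.
  have := @integral_pushforward _ _ _ _ _ X mX P setT (@EFin R) mid iX measurableT.
  rewrite /= => <-.
  have := @integral_pushforward _ _ _ _ _ (fun w => - X w) mNX P setT (@EFin R) mid iN measurableT.
  rewrite /= => <-.
  by apply: eq_measure_integral => A mA _; exact: sym.
have F : (\int[P]_w (X w)%:E)%E \is a fin_num by exact: integrable_fin_num iX.
move: E; under [in RHS]eq_integral do rewrite EFinN.
rewrite integralN; last by apply: integrable_add_def.
rewrite -(fineK F) => -[h]; congr (_%:E); lra.
Qed.
End gaussian_mean.

(** * Moments of the Ornstein-Uhlenbeck process *)

Section mfBm_moments.
Context (dT : measure_display) (T : measurableType dT) (R : realType).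
Variable P : probability T R.
Variables (d : nat) (H : 'I_d -> R) (B : 'I_d -> R -> {RV P >-> R}).
Variables (rho eta : 'I_d -> 'I_d -> R).
Hypotheses (hH : forall i, 0 < H i < 1) (hH2 : forall i, H i != 1 / 2).
Hypotheses (hB : is_mfBm H B) (hpar : mfBm_parameters H B rho eta).

(** For i = j this is the covariance of fractional Brownian motion; there
    2 H_i <> 1, so the power branch of [mfBm_cov] applies. *)
Lemma mfBm_covarianceE i j t s : covariance P (B i t) (B j s) =
  (mfBm_cov (H i + H j) (rho i j) (eta i j) t s)%:E.
Proof.
have [->|ij] := eqVneq i j; last exact: (mfBm_covariance hpar).
have [_ ->] := mfBm_marginal hB j; rewrite (mfBm_normalized hB) mul1e.
rewrite (rho_diag hpar) (eta_diag hpar) /mfBm_cov.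
have HH : H j + H j != 1.
  by apply: contra (hH2 j) => /eqP h; apply/eqP; lra.
rewrite (negbTE HH) !mulr0 !addr0 !subr0 !mul1r.
by rewrite -mulr2n -(mulr_natl (H j)) distrC.
Qed.

(** The covariance of B^i_t with itself is a finite number, so the square of
    B^i_t minus a constant is integrable. *)
Lemma integrable_mfBm i t : P.-integrable setT (EFin \o B i t).
Proof.
have mX : measurable_fun setT (B i t) by exact: measurable_funPT.
have := mfBm_covarianceE i i t t; rewrite covariance.unlock unlock.
set c := fine _ => E.
have mXc : measurable_fun setT (fun w => (B i t w - c) ^+ 2).
  by apply: measurable_funX; exact: measurable_funB.
have iXc : P.-integrable setT (fun w => ((B i t w - c) ^+ 2)%:E).
  apply/integrableP; split; first exact/measurable_EFinP.
  rewrite (_ : (\int[P]_w _)%E = (mfBm_cov (H i + H i) (rho i i) (eta i i) t t)%:E).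
    exact: ltry.
  rewrite -E; apply: eq_integral => w _.
  by rewrite gee0_abs ?lee_fin ?sqr_ge0// !fctE/= expr2.
have ic : P.-integrable setT (fun w => (1 + `|c|)%:E).
  apply/integrableP; split => //.
  by rewrite integral_cst//= probability_setT mule1 ltry.
apply: (le_integrable measurableT _ _ (integrableD measurableT iXc ic)).
  exact/measurable_EFinP.
move=> w _ /=; rewrite lee_fin [leRHS]ger0_norm; last first.
  by rewrite addr_ge0 ?sqr_ge0// addr_ge0.
apply: (@le_trans _ _ (`|B i t w - c| + `|c|)).
  by rewrite -{1}(subrK c (B i t w)) ler_normD.
rewrite addrA lerD2r -[_ ^+ 2]real_normK ?num_real//.
have := sqr_ge0 (`|B i t w - c| - 1); have := normr_ge0 (B i t w - c).
by rewrite !expr2; nra.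
Qed.

Lemma mfBm_mean0 i t : (\int[P]_w (B i t w)%:E = 0)%E.
Proof.
apply: centered_gaussian_mean0; last exact: integrable_mfBm.
have := @mfBm_gaussian _ _ _ _ _ _ _ hB 1 (fun=> (i, t)) (fun=> 1).
by under eq_fun do rewrite big_ord1 mul1r.
Qed.

Lemma mfBm_product_mean i j t s :
  (\int[P]_w (B i t w * B j s w)%:E =
   (mfBm_cov (H i + H j) (rho i j) (eta i j) t s)%:E)%E.
Proof. by rewrite -mfBm_covarianceE covariance_centered//; exact: mfBm_mean0. Qed.

Lemma integrable_mfBm_product i j t s :
  P.-integrable setT (fun w => (B i t w * B j s w)%:E).
Proof.
have isq k u : P.-integrable setT (fun w => (B k u w ^+ 2)%:E).
  have mX : measurable_fun setT (B k u) by exact: measurable_funPT.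
  apply/integrableP; split; first by apply/measurable_EFinP; exact: measurable_funX.
  rewrite (_ : (\int[P]_w _)%E = (mfBm_cov (H k + H k) (rho k k) (eta k k) u u)%:E).
    exact: ltry.
  rewrite -mfBm_product_mean; apply: eq_integral => w _.
  by rewrite gee0_abs ?lee_fin ?sqr_ge0// expr2.
apply: (le_integrable measurableT _ _ (integrableD measurableT (isq i t) (isq j s))).
  by apply/measurable_EFinP; apply: measurable_funM; exact: measurable_funPT.
move=> w _ /=; rewrite lee_fin [leRHS]ger0_norm; last first.
  by rewrite addr_ge0 ?sqr_ge0.
rewrite normrM -[B i t w ^+ 2]real_normK ?num_real//.
rewrite -[B j s w ^+ 2]real_normK ?num_real//.
have := sqr_ge0 (`|B i t w| - `|B j s w|).
by have := mulr_ge0 (normr_ge0 (B i t w)) (normr_ge0 (B j s w)); rewrite !expr2; nra.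
Qed.

Definition increment_field i t (z : T * R) : R := B i t z.1 - B i (t - z.2) z.1.
Local Notation D := increment_field.

Lemma increment_product_mean i j t s x y :
  let k := lag_kernel (H i + H j) (rho i j) (eta i j) in
  (\int[P]_w (D i t (w, x) * D j s (w, y))%:E =
   (k (t - s) - k (t - s - x) - k (t - s + y) + k (t - s - x + y))%:E)%E.
Proof.
move=> k; rewrite -mfBm_cov_increments.
have i1 := integrable_mfBm_product i j t s.
have i2 := integrable_mfBm_product i j (t - x) s.
have i3 := integrable_mfBm_product i j t (s - y).
have i4 := integrable_mfBm_product i j (t - x) (s - y).
have i12 := integrableB measurableT i1 i2.
have i123 := integrableB measurableT i12 i3.
transitivity (\int[P]_w ((B i t w * B j s w)%:E - (B i (t - x) w * B j s w)%:E
  - (B i t w * B j (s - y) w)%:E + (B i (t - x) w * B j (s - y) w)%:E))%E.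
  apply: eq_integral => w _; rewrite -!EFinB -EFinD /D/=; congr (_%:E); ring.
rewrite (integralD measurableT i123 i4) (integralB measurableT i12 i3).
by rewrite (integralB measurableT i1 i2) !mfBm_product_mean.
Qed.

Lemma continuous_mfBm i w : continuous (fun u => B i u w).
Proof. exact: (@mfBm_continuous _ _ _ _ _ _ _ hB i w). Qed.

(** The second moment of the increment over a length x is |x|^{2 H_i}. *)
Lemma quad_field_increment i t : quad_field P (D i t).
Proof.
split.
  apply: measurable_funB.
    by apply: (@measurableT_comp _ _ _ _ _ _ (B i t)) => //; exact: measurable_funPT.
  have mX := measurable_continuous_process (X := fun u => B i u)
    (fun u => measurable_funPT _) (@continuous_mfBm i).
  apply: (measurableT_comp (f := fun z : T * R => B i z.2 z.1) (g := fun z : T * R => (z.1, t - z.2)) mX).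
  by apply: measurable_fun_pair => //; exact: measurable_funB.
exists 1 => x; rewrite mul1r.
under eq_integral do rewrite expr2.
rewrite increment_product_mean subrr !sub0r !add0r addNr lee_fin.
rewrite (rho_diag hpar) (eta_diag hpar) /lag_kernel.
have HH : H i + H i != 1.
  by apply: contra (hH2 i) => /eqP h; apply/eqP; lra.
have /andP[h0 h1] := hH i.
have h02 : 0 < H i + H i < 2 by apply/andP; split; lra.
rewrite (negbTE HH) !mulr0 !subr0 !mul1r normrN normr0 powR0; last by apply: lt0r_neq0; lra.
have := powR_le_sqr x h02; set p := `|x| `^ _ => hp.
by apply: le_trans hp; rewrite le_eqVlt; apply/orP; left; apply/eqP; field.
Qed.

Lemma increment_mean0 i t x : (\int[P]_w (D i t (w, x))%:E = 0)%E.
Proof.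
under eq_integral do rewrite /D/= EFinB.
by rewrite (integralB measurableT (integrable_mfBm i t) (integrable_mfBm i (t - x)))
  !mfBm_mean0 sube0.
Qed.

Variables (alpha nu : 'I_d -> R) (Y : 'I_d -> R -> {RV P >-> R}).
Hypotheses (halpha : forall i, 0 < alpha i) (hY : is_mfOU B alpha nu Y).

Definition mfOU_mean i t w := exp_mean (alpha i) (fun x => D i t (w, x)).
Local Notation Z := mfOU_mean.

Lemma mfOU_ae i t : {ae P, forall w, Y i t w = nu i * Z i t w}.
Proof.
have := quad_field_ae_integrable (halpha i) (quad_field_increment i t).
have := hY i t; apply: filterS2 => w [l lI ->] iw; congr (_ * _).
exact: (improper_RS_value (halpha i) (@continuous_mfBm i w) iw lI).
Qed.

Lemma measurable_mfOU_mean i t : measurable_fun setT (Z i t).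
Proof. by apply: measurable_exp_mean_field; case: (quad_field_increment i t). Qed.

Lemma mfOU_mean0 i t : (\int[P]_w (Y i t w)%:E = 0)%E.
Proof.
have qD := quad_field_increment i t; have mZ := measurable_mfOU_mean i t.
transitivity (\int[P]_w (nu i * Z i t w)%:E)%E.
  apply: ae_eq_integral => //.
  - by apply/measurable_EFinP; exact: measurable_funPT.
  - by apply/measurable_EFinP; exact: measurable_funM.
  - by apply: filterS (mfOU_ae i t) => w -> _.
under eq_integral do rewrite EFinM.
rewrite integralZl//; last exact: quad_field_integrable_mean.
rewrite quad_field_expect_mean//.
rewrite (_ : exp_mean _ _ = 0) ?mule0//.
rewrite -[RHS](exp_mean_cst 0 (halpha i)); apply: exp_mean_eq => x _.
by rewrite increment_mean0.
Qed.

Lemma mfOU_covariance i j t s :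
  covariance P (Y i t) (Y j s) =
  (nu i * nu j * stat_cov (lag_kernel (H i + H j) (rho i j) (eta i j))
     (alpha i) (alpha j) (t - s))%:E.
Proof.
rewrite covariance_centered; [|exact: mfOU_mean0|exact: mfOU_mean0].
have mi := measurable_mfOU_mean i t; have mj := measurable_mfOU_mean j s.
have qi := quad_field_increment i t; have qj := quad_field_increment j s.
have [C C0 fgC] := quad_field_expect_norm qi qj.
transitivity (\int[P]_w ((nu i * nu j)%:E * (Z i t w * Z j s w)%:E))%E.
  apply: ae_eq_integral => //.
  - by apply/measurable_EFinP; apply: measurable_funM; exact: measurable_funPT.
  - by apply: emeasurable_funM => //; apply/measurable_EFinP; exact: measurable_funM.
  - apply: filterS2 (mfOU_ae i t) (mfOU_ae j s) => w -> -> _.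
    by rewrite -EFinM; congr (_%:E); ring.
rewrite integralZl//; last exact: (integrable_exp_mean2 (halpha i) (halpha j) qi qj).
rewrite (quad_field_expect_mean2 (halpha i) (halpha j) qi qj) -EFinM.
apply: (congr1 (fun z => (nu i * nu j * z)%:E)).
apply: exp_mean_eq => x _; apply: exp_mean_eq => y _.
by rewrite increment_product_mean.
Qed.
End mfBm_moments.

(** * Strict stationarity *)

Section mfOU_stationary.
Context (dT : measure_display) (T : measurableType dT) (R : realType).
Variable P : probability T R.
Variables (d : nat) (H : 'I_d -> R) (B : 'I_d -> R -> {RV P >-> R}).
Hypothesis hB : is_mfBm H B.
Variables (alpha nu : 'I_d -> R) (Y : 'I_d -> R -> {RV P >-> R}).
Hypotheses (halpha : forall i, 0 < alpha i) (hY : is_mfOU B alpha nu Y).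

Definition shifted_increment h (p : 'I_d * R) w := B p.1 (p.2 + h) w - B p.1 h w.

(** The approximation of Y_{t+h} by a left-tagged sum over m + 1 cells of
    [t + h - (n + 1), t + h]. *)
Definition mfOU_sum n m h (p : 'I_d * R) w : R :=
  nu p.1 * grid_sum (fun u => expR (- alpha p.1 * (p.2 + h - u)))
    (fun u => B p.1 u w) (p.2 + h - n.+1%:R) (p.2 + h) m.

(** The limit of [mfOU_sum] when the mesh tends to 0. *)
Definition mfOU_truncated n h (p : 'I_d * R) w : R :=
  nu p.1 * RS_exp_formula (alpha p.1) (fun u => B p.1 u w) (p.2 + h) n.+1%:R.

Let node n m (p : 'I_d * R) k := grid (p.2 - n.+1%:R) p.2 m k.

(** The weights and the nodes on the right do not depend on [h]; the boolean
    selects the endpoint of a cell. *)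
Lemma mfOU_sum_increments n m h p w : mfOU_sum n m h p w =
  \sum_(kb : 'I_m.+1 * bool)
    (nu p.1 * expR (- alpha p.1 * (p.2 - node n m p kb.1)) * (if kb.2 then 1 else - 1)) *
    shifted_increment h (p.1, node n m p (if kb.2 then kb.1.+1 else kb.1)) w.
Proof.
rewrite /mfOU_sum /grid_sum mulr_sumr.
rewrite -(pair_bigA _ (fun (k : 'I_m.+1) (b : bool) =>
    (nu p.1 * expR (- alpha p.1 * (p.2 - node n m p k)) * (if b then 1 else - 1)) *
    shifted_increment h (p.1, node n m p (if b then k.+1 else k)) w))/=.
apply: eq_bigr => k _; rewrite big_bool /shifted_increment/=.
have E j : grid (p.2 + h - n.+1%:R) (p.2 + h) m j = node n m p j + h.
  by rewrite /node /grid; ring.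
rewrite !E (_ : p.2 + h - (node n m p k + h) = p.2 - node n m p k); last by ring.
by ring.
Qed.

Lemma same_fdd_mfOU_sum n m h : same_fdd P (mfOU_sum n m h) (mfOU_sum n m 0).
Proof.
have E h' : mfOU_sum n m h' = (fun p w => \sum_(kb : 'I_m.+1 * bool)
    (nu p.1 * expR (- alpha p.1 * (p.2 - node n m p kb.1)) * (if kb.2 then 1 else - 1)) *
    shifted_increment h' (p.1, node n m p (if kb.2 then kb.1.+1 else kb.1)) w).
  by apply/funext => p; apply/funext => w; exact: mfOU_sum_increments.
rewrite !E; apply: same_fdd_linear.
have := mfBm_stationary_increments hB h.
rewrite (_ : (fun p w => B p.1 p.2 w - B p.1 0 w) = shifted_increment 0)//.
by apply/funext => p; apply/funext => w; rewrite /shifted_increment addr0.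
Qed.

Lemma measurable_mfOU_sum n m h p : measurable_fun setT (mfOU_sum n m h p).
Proof.
rewrite (funext (fun w => mfOU_sum_increments n m h p w)).
apply: measurable_sum => kb; apply: measurable_funM => //.
by apply: measurable_funB; exact: measurable_funPT.
Qed.

Lemma mfOU_sum_cvg n h p w :
  mfOU_sum n m h p w @[m --> \oo] --> mfOU_truncated n h p w.
Proof.
have cB : continuous (fun u => B p.1 u w) by exact: (@mfBm_continuous _ _ _ _ _ _ _ hB).
have n0 : (0 : R) < n.+1%:R by [].
apply: cvgM; first exact: cvg_cst.
exact (@grid_sum_exp R (alpha p.1) (fun u => B p.1 u w) (p.2 + h) n.+1%:R
  (halpha p.1) n0 cB).
Qed.

Lemma measurable_mfOU_truncated n h p : measurable_fun setT (mfOU_truncated n h p).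
Proof.
apply: (@measurable_fun_cvg _ _ _ setT (fun m => mfOU_sum n m h p)) => //.
- by move=> m; exact: measurable_mfOU_sum.
- by move=> w _; exact: mfOU_sum_cvg.
Qed.

Lemma mfOU_truncated_cvg h (p : 'I_d * R) :
  {ae P, forall w, mfOU_truncated n h p w @[n --> \oo] --> Y p.1 (p.2 + h) w}.
Proof.
have := hY p.1 (p.2 + h); apply: filterS => w [l lI ->].
apply: cvgM; first exact: cvg_cst.
have cB : continuous (fun u => B p.1 u w) by exact: (@mfBm_continuous _ _ _ _ _ _ _ hB).
have := improper_RS_formula (halpha p.1) cB lI.
move=> /cvg_pinftyP/(_ (fun n => n.+1%:R)); apply.
rewrite (cvg_shiftS (fun n => n%:R : R)); exact: cvgr_idn.
Qed.

Lemma mfOU_strictly_stationary : strictly_stationary Y.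
Proof.
move=> h.
have trunc n : same_fdd P (mfOU_truncated n h) (mfOU_truncated n 0).
  apply: (same_fdd_lim (X := fun m => mfOU_sum n m h) (X' := fun m => mfOU_sum n m 0)).
  - by move=> m p; exact: measurable_mfOU_sum.
  - by move=> m p; exact: measurable_mfOU_sum.
  - by move=> p; exact: measurable_mfOU_truncated.
  - by move=> p; exact: measurable_mfOU_truncated.
  - by move=> m; exact: same_fdd_mfOU_sum.
  - by move=> p; apply: aeW => w; exact: mfOU_sum_cvg.
  - by move=> p; apply: aeW => w; exact: mfOU_sum_cvg.
apply: (same_fdd_lim (X := fun n => mfOU_truncated n h) (X' := fun n => mfOU_truncated n 0)).
- by move=> n p; exact: measurable_mfOU_truncated.
- by move=> n p; exact: measurable_mfOU_truncated.
- by move=> p; exact: measurable_funPT.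
- by move=> p; exact: measurable_funPT.
- exact: trunc.
- exact: mfOU_truncated_cvg.
- by move=> p; have := mfOU_truncated_cvg 0 p; rewrite addr0.
Qed.
End mfOU_stationary.

(** * Covariances and correlations of the Ornstein-Uhlenbeck process *)

Lemma Gamma_ge0 (R : realType) (a : R) : 0 <= Gamma a.
Proof. by apply: Rintegral_ge0 => x _; rewrite mulr_ge0 ?powR_ge0 ?expR_ge0. Qed.

Theorem theorem2p4 (dT : measure_display) (T : measurableType dT)
  (R : realType) (P : probability T R) (d : nat)
  (H alpha nu : 'I_d -> R) (rho eta : 'I_d -> 'I_d -> R)
  (B Y : 'I_d -> R -> {RV P >-> R})
  (hH : forall i, 0 < H i < 1) (hH2 : forall i, H i != 1 / 2)
  (halpha : forall i, 0 < alpha i) (hnu : forall i, 0 < nu i)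
  (hB : is_mfBm H B) (hpar : mfBm_parameters H B rho eta)
  (hY : is_mfOU B alpha nu Y) :
  [/\ strictly_stationary Y,
      forall i t, ('E_P[Y i t] = 0)%E,
      (forall i j, H i + H j != 1 ->
        (forall t s : R, s < t ->
           covariance P (Y i t) (Y j s) =
           ((expR (- alpha i * (t - s)))%R%:E * covariance P (Y i 0%R) (Y j 0%R) +
            (nu i * nu j * expR (- alpha i * (t - s)) *
              (H i + H j) * (H i + H j - 1) * ((rho i j + eta i j) / 2) *
              mfOU_I (H i + H j) (alpha i) (alpha j) (t - s))%R%:E)%E) /\
        covariance P (Y i 0) (Y j 0) =
          (Gamma (H i + H j + 1) * nu i * nu j / (2 * (alpha i + alpha j)) *
           ((alpha i `^ (1 - (H i + H j)) + alpha j `^ (1 - (H i + H j))) *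
              rho i j +
            (alpha j `^ (1 - (H i + H j)) - alpha i `^ (1 - (H i + H j))) *
              eta i j))%:E),
      (forall i j, H i + H j = 1 ->
        (forall t s : R, s < t ->
           covariance P (Y i t) (Y j s) =
           ((expR (- alpha i * (t - s)))%R%:E * covariance P (Y i 0%R) (Y j 0%R) -
            (nu i * nu j * expR (- alpha i * (t - s)) * (eta i j / 2) *
              mfOU_I (H i + H j) (alpha i) (alpha j) (t - s))%R%:E)%E) /\
        covariance P (Y i 0) (Y j 0) =
          (nu i * nu j / (alpha i + alpha j) *
           (rho i j + eta i j / 2 * (ln (alpha j) - ln (alpha i))))%:E) &
      forall i j (t : R),
        (H i + H j != 1 ->
          correlation P (Y i t) (Y j t) =
          Gamma (H i + H j + 1) /
            Num.sqrt (Gamma (2 * H i + 1) * Gamma (2 * H j + 1)) *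
          (alpha i `^ H i * alpha j `^ H j / (alpha i + alpha j)) *
          ((alpha i `^ (1 - (H i + H j)) + alpha j `^ (1 - (H i + H j))) *
             rho i j +
           (alpha j `^ (1 - (H i + H j)) - alpha i `^ (1 - (H i + H j))) *
             eta i j)) /\
        (H i + H j = 1 ->
          correlation P (Y i t) (Y j t) =
          1 / Num.sqrt (Gamma (2 * H i + 1) * Gamma (2 * H j + 1)) *
          (2 * (alpha i `^ H i * alpha j `^ H j) / (alpha i + alpha j)) *
          (rho i j + eta i j / 2 * (ln (alpha j) - ln (alpha i))))].
Proof.
have HHlt i j : 0 < H i + H j < 2.
  by have /andP[? ?] := hH i; have /andP[? ?] := hH j; apply/andP; split; lra.
have covY := mfOU_covariance hH hH2 hB hpar halpha hY.
have ab0 i j : alpha i + alpha j != 0 by rewrite gt_eqF// addr_gt0.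
have cov0_neq1 i j t : H i + H j != 1 -> covariance P (Y i t) (Y j t) =
    (Gamma (H i + H j + 1) * nu i * nu j / (2 * (alpha i + alpha j)) *
     ((alpha i `^ (1 - (H i + H j)) + alpha j `^ (1 - (H i + H j))) * rho i j +
      (alpha j `^ (1 - (H i + H j)) - alpha i `^ (1 - (H i + H j))) * eta i j))%:E.
  move=> h1; rewrite covY subrr stat_cov_lag0_neq1//; congr (_%:E).
  by field; exact: ab0.
have cov0_eq1 i j t : H i + H j = 1 -> covariance P (Y i t) (Y j t) =
    (nu i * nu j / (alpha i + alpha j) *
     (rho i j + eta i j / 2 * (ln (alpha j) - ln (alpha i))))%:E.
  move=> h1; rewrite covY subrr h1 stat_cov_lag0_eq1//; congr (_%:E).
  by field; exact: ab0.
have varY i t : fine 'V_P[Y i t] =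
    nu i ^+ 2 * (Gamma (2 * H i + 1) / (2 * (alpha i `^ H i) ^+ 2)).
  have HH : H i + H i != 1.
    by apply: contra (hH2 i) => /eqP h; apply/eqP; lra.
  rewrite /variance cov0_neq1//= (rho_diag hpar) (eta_diag hpar).
  have -> : H i + H i + 1 = 2 * H i + 1 by ring.
  have p0 := powR_gt0 (H i) (halpha i).
  have -> : alpha i `^ (1 - (H i + H i)) = alpha i / (alpha i `^ H i) ^+ 2.
    rewrite powRD; last by apply/implyP => _; exact: lt0r_neq0.
    rewrite powRr1 ?ltW// powRN powRD; last by apply/implyP => _; exact: lt0r_neq0.
    by rewrite expr2.
  by field; rewrite ab0 (lt0r_neq0 p0).
have sqV i t : Num.sqrt (fine 'V_P[Y i t]) =
    nu i * Num.sqrt (Gamma (2 * H i + 1)) / (Num.sqrt 2 * alpha i `^ H i).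
  have p0 := powR_gt0 (H i) (halpha i).
  rewrite varY sqrtrM ?sqr_ge0// sqrtr_sqr gtr0_norm// -mulrA; congr (_ * _).
  rewrite sqrtrM ?Gamma_ge0// sqrtrV ?mulr_ge0 ?sqr_ge0 ?powR_ge0//.
  by rewrite sqrtrM// sqrtr_sqr gtr0_norm.
have corr i j t c : covariance P (Y i t) (Y j t) = (nu i * nu j * c)%:E ->
    correlation P (Y i t) (Y j t) =
    2 * (alpha i `^ H i * alpha j `^ H j) * c /
      Num.sqrt (Gamma (2 * H i + 1) * Gamma (2 * H j + 1)).
  move=> E; rewrite /correlation E/= !sqV sqrtrM ?Gamma_ge0//.
  have ai0 := lt0r_neq0 (powR_gt0 (H i) (halpha i)).
  have aj0 := lt0r_neq0 (powR_gt0 (H j) (halpha j)).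
  have ni0 := lt0r_neq0 (hnu i); have nj0 := lt0r_neq0 (hnu j).
  have s2 : Num.sqrt 2 * Num.sqrt 2 = 2 :> R by rewrite -expr2 sqr_sqrtr.
  have s20 : Num.sqrt 2 != 0 :> R by rewrite gt_eqF// sqrtr_gt0.
  set gi := Num.sqrt (Gamma (2 * H i + 1)); set gj := Num.sqrt (Gamma (2 * H j + 1)).
  (* If a Gamma factor vanished, both sides would be quotients by 0, hence 0. *)
  have [->|gi0] := eqVneq gi 0; first by rewrite !(mulr0, mul0r, invr0).
  have [->|gj0] := eqVneq gj 0; first by rewrite !(mulr0, mul0r, invr0).
  rewrite -[X in X * (alpha i `^ _ * _)]s2; field.
  by rewrite gj0 gi0 s20 ai0 aj0 ni0 nj0.
split.
- exact: (mfOU_strictly_stationary hB halpha hY).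
- by move=> i t; rewrite unlock; exact: (mfOU_mean0 hH hH2 hB hpar halpha hY).
- move=> i j h1; split; last exact: cov0_neq1.
  move=> t s st; rewrite !covY subrr stat_cov_lag ?subr_gt0//.
  rewrite /lag_curvature (negbTE h1) -EFinM -EFinD; congr (_%:E).
  by ring.
- move=> i j h1; split; last exact: cov0_eq1.
  move=> t s st; rewrite !covY subrr stat_cov_lag ?subr_gt0//.
  rewrite /lag_curvature h1 eqxx -EFinM -EFinB; congr (_%:E).
  by field.
- move=> i j t; split => h1.
    rewrite (corr _ _ _ (Gamma (H i + H j + 1) / (2 * (alpha i + alpha j)) *
      ((alpha i `^ (1 - (H i + H j)) + alpha j `^ (1 - (H i + H j))) * rho i j +
       (alpha j `^ (1 - (H i + H j)) - alpha i `^ (1 - (H i + H j))) * eta i j))).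
      set gg := (Num.sqrt _)^-1; rewrite -/gg.
      by field; exact: ab0.
    by rewrite cov0_neq1//; congr (_%:E); field; exact: ab0.
  rewrite (corr _ _ _ ((alpha i + alpha j)^-1 *
    (rho i j + eta i j / 2 * (ln (alpha j) - ln (alpha i))))).
    set gg := (Num.sqrt _)^-1; rewrite -/gg.
    by field; exact: ab0.
  by rewrite cov0_eq1//; congr (_%:E); field; exact: ab0.
Qed.
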